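(* Assume (H1), (H2), (H3). Fix $t>0$. Then: (i) the series $r(t,\infty,x)=\sum_{k\ge1}e^{-\lambda_kt}\psi_k(\infty)\psi_k(x)$ converges, and as $y\to\infty$, $r(t,y,\cdot)\to r(t,\infty,\cdot)$ in $L^p(\mu)$ for every $p\ge1$; in particular $r(t,\infty,\cdot)\in L^p(\mu)$ for all $p\ge1$ and it is a bounded continuous function; (ii) for every bounded measurable $f:\mathbb R_+\to\mathbb R$, $$\mathbb E\big(f(X^\infty_t);\mathbb T^{(\infty)}_0>t\big)=\int_0^\infty r(t,\infty,x)f(x)\,2e^{-\gamma(x)}dx,$$ i.e. $r(t,\infty,x)2e^{-\gamma(x)}dx$ is a density of $\mathbb P(X^\infty_t\in\cdot\,;\mathbb T^{(\infty)}_0>t)$; (iii) for every $p\ge1$ and $f\in L^p(\mu)$, $$\lim_{z\to\infty}\mathbb E\big(f(X^z_t);\mathbb T^{(z)}_0>t\big)=\mathbb E\big(f(X^\infty_t);\mathbb T^{(\infty)}_0>t\big)=\int_0^\infty r(t,\infty,x)f(x)\,2e^{-\gamma(x)}dx.$$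
   Context: Let $q\in C^1([0,\infty))$, $B$ a standard Brownian motion (law $\mathbb P$, expectation $\mathbb E$), $X^x$ the solution of $dX^x_t=dB_t-q(X^x_t)dt$, $X^x_0=x$, stopped at $0$, $\mathbb T^{(x)}_z=\inf\{t\ge0:X^x_t=z\}$. $\gamma(y)=2\int_0^yq$, $\mu(dx)=2e^{-\gamma(x)}dx$ on $[0,\infty)$, $\mathcal Lu=\frac12u''-qu'$. (H1): $\int_0^\infty e^{\gamma(y)}\int_y^\infty e^{-\gamma(\xi)}d\xi\,dy<\infty$. (H2): $q(x)\to\infty$ and $q'(x)/q(x)^2\to0$. (H3): there exist $a>0$, $x_0\ge0$ with $\inf\{q(y):y\ge x\}\ge a\,q(x)$ for all $x\ge x_0$. Under (H1), $X^\infty_t=\lim_{x\to\infty}X^x_{t\wedge\mathbb T^{(x)}_0}$ (a.s. monotone limit) and $\mathbb T^{(\infty)}_0=\lim_x\mathbb T^{(x)}_0$. Known spectral facts under (H1),(H2): the generator on $L^2(\mu)$ of $X$ killed at $0$ has purely discrete simple spectrum $-\lambda_1>-\lambda_2>\cdots$ with $0<\lambda_1<\lambda_2<\cdots$ and $L^2(\mu)$-orthonormal eigenfunctions $\psi_k\in C^2$, $\mathcal L\psi_k=-\lambda_k\psi_k$, $\psi_k(0)=0$; each $\psi_k$ is bounded with finite limit $\psi_k(\infty)$. For finite $y>0$, $\mathbb P(X^y_t\in dx,\mathbb T^{(y)}_0>t)=r(t,y,x)2e^{-\gamma(x)}dx$ with $r(t,y,x)=\sum_{k\ge1}e^{-\lambda_kt}\psi_k(y)\psi_k(x)$.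 *)

(* Defs.v *)
From HB Require Import structures.
From mathcomp Require Import all_boot all_order all_algebra.
From mathcomp Require Import all_classical all_reals all_analysis.
From mathcomp Require Import measurable_realfun.
Set Implicit Arguments.
Unset Strict Implicit.
Unset Printing Implicit Defensive.
Import Order.TTheory GRing.Theory Num.Theory.
Import numFieldNormedType.Exports.
Local Open Scope classical_set_scope.
Local Open Scope ring_scope.

Section defs.
Context {R : realType}.
Local Notation leb := (@lebesgue_measure R).

Definition gam (q : R -> R) (y : R) : R := 2 * Rintegral leb `[0, y] q.

Definition dens (q : R -> R) (x : R) : R := 2 * expR (- gam q x).

Definition muint (q : R -> R) (f : R -> R) : \bar R :=
  (\int[leb]_(x in `[0%R, +oo[%classic) (f x * dens q x)%:E)%E.

Definition Lp (q : R -> R) (p : R) (f : R -> R) : Prop :=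
  measurable_fun (`[0%R, +oo[%classic : set R) f /\ (muint q (fun x => (`|f x| `^ p)%R) < +oo)%E.

Definition C1_on_halfline (q dq : R -> R) : Prop :=
  (forall x : R, 0 < x -> is_derive x 1 q (dq x)) /\
  ((q h - q 0) / h @[h --> 0^'+] --> dq 0) /\
  {within `[0%R, +oo[%classic, continuous dq}.

Definition H1 (q : R -> R) : Prop :=
  (\int[leb]_(y in `[0%R, +oo[%classic)
     ((expR (gam q y))%:E * \int[leb]_(xi in `[y, +oo[%classic) (expR (- gam q xi))%:E)
   < +oo)%E.

Definition H2 (q dq : R -> R) : Prop :=
  ((fun x : R => q x) @ +oo --> +oo) /\ ((fun x : R => dq x / q x ^+ 2) @ +oo --> 0).

(** inf{q(y) : y >= x} >= a q(x), written out *)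
Definition H3 (q : R -> R) : Prop :=
  exists a x0, 0 < a /\ 0 <= x0 /\
    forall x, x0 <= x -> forall y, x <= y -> a * q x <= q y.

(** the series sum_k e^{-lam_k t} c_k psi_k(x); with c_k = psi_k(y) this is r(t,y,x),
    with c_k = psi_k(oo) it is r(t,oo,x) *)
Definition rker (lam : nat -> R) (c : nat -> R) (psi : nat -> R -> R) (t x : R) : R :=
  limn (series (fun k => expR (- lam k * t) * c k * psi k x)).

Definition hit (Y : R -> R) (z : R) : \bar R :=
  ereal_inf [set t%:E | t in [set t | 0 <= t /\ Y t = z]].

Definition stopt (t : R) (T : \bar R) : R := if (T < t%:E)%E then fine T else t.

Section proba.
Context {d : measure_display} {Omega : measurableType d} (P : probability Omega R).

Definition indep_family (n : nat) (Y : nat -> Omega -> R) : Prop :=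
  forall A : nat -> set R, (forall i, measurable (A i)) ->
    P [set w | forall i, (i < n)%N -> A i (Y i w)] =
    (\prod_(i < n) P (Y i @^-1` A i))%E.

Definition brownian_motion (B : R -> Omega -> R) : Prop :=
  (forall t, 0 <= t -> measurable_fun setT (B t)) /\
  (forall w, B 0 w = 0) /\
  (forall w, {within `[0%R, +oo[%classic, continuous (fun t => B t w)}) /\
  (forall s t, 0 <= s -> s < t -> forall A : set R, measurable A ->
     P ((fun w => B t w - B s w) @^-1` A) = normal_prob 0 (Num.sqrt (t - s)) A) /\
  (forall (n : nat) (tau : nat -> R), 0 <= tau 0 ->
     (forall i, (i < n)%N -> tau i < tau i.+1) ->
     indep_family n (fun i w => B (tau i.+1) w - B (tau i) w)).

(** the path s |-> Y s w solves dY = dB - q(Y) dt, Y_0 = x, stopped at 0 *)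
Definition stopped_solution (q : R -> R) (B : R -> Omega -> R) (x : R)
    (Y : R -> Omega -> R) (w : Omega) : Prop :=
  {within `[0%R, +oo[%classic, continuous (fun s => Y s w)} /\
  forall t, 0 <= t ->
    Y t w = x + B (stopt t (hit (fun s => Y s w) 0)) w
            - Rintegral leb `[0, stopt t (hit (fun s => Y s w) 0)] (fun s => q (Y s w)).

End proba.
End defs.

(* Main.v *)
Require Import Defs.
From HB Require Import structures.
From mathcomp Require Import all_boot all_order all_algebra.
From mathcomp Require Import all_classical all_reals all_analysis.
From mathcomp Require Import measurable_realfun.
From mathcomp Require Import ring lra.
Import Order.TTheory GRing.Theory Num.Theory.
Import numFieldNormedType.Exports.
Local Open Scope classical_set_scope.
Local Open Scope ring_scope.

(** Everything follows from a bound [|psi_k| <= m_k] on the whole half-line with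
    [sum_k e^(- lam_k t) m_k^2] finite: the series for [r] then converge uniformly,
    and dominated convergence for series gives [r(t,y,.) -> r(t,oo,.)] uniformly.

    The bound is obtained as follows.  Put [J(x) = int_x^oo e^-gamma],
    [h = e^gamma J], [H(x) = int_x^oo h] (finite by (H1)) and
    [La(x) = int_0^x e^gamma].  Orthonormality and Bessel's inequality for the
    derivatives give [sum_k psi_k(x)^2 / lam_k <= La(x)], which controls
    [psi_k(x)] for moderate [x] and, integrated against [mu], yields
    [sum_k 1 / lam_k < oo].  Where [8 lam h^2 <= 1], an energy argument shows that
    [psi^2] grows at most by the factor [e^(8 lam H)].  By (H3),
    [sup_(y >= x) h(y)^2 gamma(x) -> 0], so that both regimes can be glued at a
    point [x1] with [gamma(x1) = delta lam], giving
    [psi_k^2 <= C lam_k e^(9 delta lam_k)] for every [delta > 0].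

    For the law at infinity, the almost sure convergence gives
    [P(X^oo_t in U, T^oo > t) <= int_U r(t,oo,.) dmu] for open [U] by Fatou's lemma;
    the total masses agree because [s |-> int r(s,oo,.) dmu] is right-continuous,
    whence equality on all Borel sets. *)

(** * Calculus *)

Section calculus.
Set Implicit Arguments.
Unset Strict Implicit.
Context {R : realType}.
Implicit Types (f g df : R -> R) (a b c x y z l : R).

(** The given spectral facts bound each [psi k] separately, with no rate in [k]. Since [t] may be
    arbitrarily small, a bound of order [e^(eps lam_k)] for every [eps > 0] is required, and neither
    estimate yields it alone: the Bessel bound involves [La], which may grow like [e^gamma], while
    the energy argument needs [lam h^2] small. The role of (H3) is to reconcile them. It gives
    [h = O(1/q)], [gamma(x) = O(x q(x))] and [x = o(q(x))], hence [h^2 gamma -> 0]: the energy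
    argument already works from a height of [gamma] that is a small multiple of [lam], and up to
    that height [La] costs only [e^(delta lam)]. The Bessel inequality itself comes from the
    derivatives: [psi_k' / sqrt(lam_k)] is orthonormal in [L^2(e^-gamma)], and [psi_k(x)] is the
    inner product of [psi_k'] with [e^gamma 1_[0,x]]. In these estimates [J], [H] and [La] enter
    only through their derivatives and their limits at 0 and at infinity; each inequality is the
    monotonicity of an explicit function, compared with its limit. *)

Lemma is_derive1_eq f x a b : is_derive x 1 f a -> a = b -> is_derive x 1 f b.
Proof. by move=> ? <-. Qed.

Lemma is_derive1_cst c x : is_derive x 1 (fun=> c) 0.
Proof. exact: is_derive_cst. Qed.

Lemma is_derive1_id x : is_derive x 1 (fun y : R => y) 1.
Proof. exact: is_derive_id. Qed.

Lemma is_derive1D f g x a b : is_derive x 1 f a -> is_derive x 1 g b ->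
  is_derive x 1 (fun y => f y + g y) (a + b).
Proof. by move=> ? ?; exact: is_deriveD. Qed.

Lemma is_derive1N f x a : is_derive x 1 f a -> is_derive x 1 (fun y => - f y) (- a).
Proof. by move=> ?; exact: is_deriveN. Qed.

Lemma is_derive1M f g x a b : is_derive x 1 f a -> is_derive x 1 g b ->
  is_derive x 1 (fun y => f y * g y) (a * g x + f x * b).
Proof.
move=> fa gb; apply: is_derive1_eq (is_deriveM fa gb) _.
by rewrite /GRing.scale/= addrC [g x * _]mulrC.
Qed.

Lemma is_derive1_expR f x a : is_derive x 1 f a ->
  is_derive x 1 (fun y => expR (f y)) (a * expR (f x)).
Proof.
move=> fa; have := @is_derive1_comp R expR f x _ a (is_derive_expR (f x)) fa.
by move=> /is_derive1_eq; apply; rewrite mulrC.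
Qed.

Lemma is_derive1_sum n (F : 'I_n -> R -> R) (a : 'I_n -> R) x :
  (forall k, is_derive x 1 (F k) (a k)) ->
  is_derive x 1 (fun y => \sum_(k < n) F k y) (\sum_(k < n) a k).
Proof.
elim: n => [|n ih] in F a * => Fa.
  by under eq_fun do rewrite big_ord0; rewrite big_ord0; exact: is_derive_cst.
under eq_fun do rewrite big_ord_recr/=.
by rewrite big_ord_recr/=; apply: is_derive1D => //; exact: ih.
Qed.

Lemma ge0_derive_le f df x y : x <= y ->
  (forall z, x <= z -> z <= y -> is_derive z 1 f (df z)) ->
  (forall z, x <= z -> z <= y -> 0 <= df z) -> f x <= f y.
Proof.
move=> xy fdf df0; have [||c cxy] := @MVT_segment R f df x y xy.
- by move=> z; rewrite in_itv/= => /andP[xz zy]; apply: fdf; exact: ltW.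
- apply: derivable_within_continuous => z; rewrite in_itv/= => /andP[xz zy].
  by have := fdf z xz zy => -[].
- move: cxy; rewrite in_itv/= => /andP[xc cy] fE.
  by rewrite -subr_ge0 fE mulr_ge0 ?subr_ge0// df0.
Qed.

Lemma le0_derive_ge f df x y : x <= y ->
  (forall z, x <= z -> z <= y -> is_derive z 1 f (df z)) ->
  (forall z, x <= z -> z <= y -> df z <= 0) -> f y <= f x.
Proof.
move=> xy fdf df0; rewrite -lerN2.
apply: (@ge0_derive_le (fun z => - f z) (fun z => - df z)) => // z xz zy.
  exact/is_derive1N/fdf.
by rewrite oppr_ge0 df0.
Qed.

Lemma ge0_derive_le_limy f df l x :
  (forall z, x <= z -> is_derive z 1 f (df z)) ->
  (forall z, x <= z -> 0 <= df z) -> f y @[y --> +oo] --> l -> f x <= l.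
Proof.
move=> fdf df0 fl; apply: (cvgr_to_ge fl); near=> y.
have xy : x <= y by near: y; apply: nbhs_pinfty_ge; exact: num_real.
by apply: (@ge0_derive_le f df) => // z xz _; [exact: fdf|exact: df0].
Unshelve. all: by end_near. Qed.

Lemma le0_derive_ge_limy f df l x :
  (forall z, x <= z -> is_derive z 1 f (df z)) ->
  (forall z, x <= z -> df z <= 0) -> f y @[y --> +oo] --> l -> l <= f x.
Proof.
move=> fdf df0 fl; apply: (cvgr_to_le fl); near=> y.
have xy : x <= y by near: y; apply: nbhs_pinfty_ge; exact: num_real.
by apply: (@le0_derive_ge f df) => // z xz _; [exact: fdf|exact: df0].
Unshelve. all: by end_near. Qed.

Lemma ge0_derive_lim0_le f df l x : 0 < x ->
  (forall z, 0 < z -> is_derive z 1 f (df z)) ->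
  (forall z, 0 < z -> 0 <= df z) -> f y @[y --> 0^'+] --> l -> l <= f x.
Proof.
move=> x0 fdf df0 fl; apply: (cvgr_to_le fl); near=> y.
have y0 : 0 < y by near: y; exact: nbhs_right_gt.
have yx : y <= x by near: y; exact: nbhs_right_le.
by apply: (@ge0_derive_le f df) => // z yz _;
  [apply: fdf|apply: df0]; exact: lt_le_trans yz.
Unshelve. all: by end_near. Qed.

End calculus.

(* [is_derive] is a type class: [notypeclasses] prevents its instances from
   being used on the subgoals. *)
Ltac derive1 := lazymatch goal with
  | |- is_derive _ _ (fun _ => ?c) _ => notypeclasses refine (is_derive1_cst _ _)
  | |- is_derive _ _ (fun x => x) _ => notypeclasses refine (is_derive1_id _)
  | |- is_derive _ _ -%R _ => exact: is_derive1N (is_derive1_id _)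
  | |- is_derive _ _ ( *%R ?c) _ =>
      exact: is_derive1M (is_derive1_cst c _) (is_derive1_id _)
  | |- is_derive _ _ (fun x => - _) _ => notypeclasses refine (is_derive1N _)
  | |- is_derive _ _ (fun x => _ + _) _ => notypeclasses refine (is_derive1D _ _)
  | |- is_derive _ _ (fun x => _ * _) _ => notypeclasses refine (is_derive1M _ _)
  | |- is_derive _ _ (fun x => expR _) _ => notypeclasses refine (is_derive1_expR _)
  | H : forall x, _ -> is_derive x _ ?f _ |- is_derive _ _ ?f _ =>
      notypeclasses refine (H _ _); assumption
  end.
Ltac derive := notypeclasses refine (is_derive1_eq _ _); [repeat derive1|cbv beta].

(** * Scale function, tail integrals, and the flux of a bounded eigenfunction *)

Section scale.
Set Implicit Arguments.
Unset Strict Implicit.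
Context {R : realType}.
Variables (q g J H La : R -> R).
Implicit Types x y z X M lam : R.

(** Once [q >= 1] the slope of [g] is at least 2. The bound serves twice: it drives [g] to infinity,
    and it makes [expR (- g x)] integrable by comparison with an exponential. *)
Lemma linear_lower_bound :
  (forall x, 0 < x -> is_derive x 1 g (2 * q x)) -> q x @[x --> +oo] --> +oo ->
  exists2 X, 0 < X & forall x, X <= x -> g X + (x - X) <= g x.
Proof.
move=> Dg /cvgryPge/(_ 1)[X [_ qX]].
(* [q >= 1] is known only strictly beyond [X], and [g] is differentiable only at positive points. *)
exists (Num.max X 1 + 1); first by rewrite ltr_wpDl// le_max ler01 orbT.
set Y := _ + 1 => x Yx; suff : g Y - Y <= g x - x by lra.
have Y0 : 0 < Y by rewrite ltr_wpDl// le_max ler01 orbT.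
apply: (@ge0_derive_le _ (fun x => g x - x) (fun x => 2 * q x - 1)) => //.
  move=> z Yz _; have z0 : 0 < z by exact: lt_le_trans Yz.
  by derive; ring.
move=> z Yz _; have : 1 <= q z.
  by apply: qX; apply: lt_le_trans Yz; rewrite /Y ltr_pwDr// le_max lexx.
lra.
Qed.

(* [g = gamma], [J x = int_x^oo e^-g], [H x = int_x^oo e^g J] and [La] is the
   scale function. *)
Record scale_data : Prop := ScaleData {
  scale_g : forall x, 0 < x -> is_derive x 1 g (2 * q x) ;
  scale_J : forall x, 0 < x -> is_derive x 1 J (- expR (- g x)) ;
  scale_H : forall x, 0 < x -> is_derive x 1 H (- (expR (g x) * J x)) ;
  scale_La : forall x, 0 < x -> is_derive x 1 La (expR (g x)) ;
  scale_qy : q x @[x --> +oo] --> +oo ;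
  scale_Jy : J x @[x --> +oo] --> 0 ;
  scale_Hy : H x @[x --> +oo] --> 0 ;
  scale_J0 : J x @[x --> 0^'+] --> J 0 ;
  scale_H0 : H x @[x --> 0^'+] --> H 0 ;
  scale_La0 : La x @[x --> 0^'+] --> 0 }.

Hypothesis D : scale_data.
Let Dg := scale_g D.
Let DJ := scale_J D.
Let DH := scale_H D.
Let DLa := scale_La D.

Lemma scale_J_ge0 x : 0 < x -> 0 <= J x.
Proof.
move=> x0; apply: (@le0_derive_ge_limy _ J (fun z => - expR (- g z)) _ _ _ _ (scale_Jy D)) => z xz.
  by apply: DJ; exact: lt_le_trans xz.
by rewrite oppr_le0 expR_ge0.
Qed.

Lemma scale_H_ge0 x : 0 < x -> 0 <= H x.
Proof.
move=> x0; apply: (@le0_derive_ge_limy _ H (fun z => - (expR (g z) * J z)) _ _ _ _ (scale_Hy D)) => z xz.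
  by apply: DH; exact: lt_le_trans xz.
by rewrite oppr_le0 mulr_ge0 ?expR_ge0 ?scale_J_ge0// (lt_le_trans x0).
Qed.

Lemma scale_La_le x y : 0 < x -> x <= y -> La x <= La y.
Proof.
move=> x0 xy; apply: (@ge0_derive_le _ La (fun z => expR (g z)) _ _ xy) => z xz _.
  by apply: DLa; exact: lt_le_trans xz.
exact: expR_ge0.
Qed.

Lemma scale_La_ge0 x : 0 < x -> 0 <= La x.
Proof.
move=> x0; apply: (@ge0_derive_lim0_le _ La (fun z => expR (g z)) _ _ x0 _ _ (scale_La0 D)) => z z0.
  exact: DLa.
exact: expR_ge0.
Qed.

Lemma scale_gy : g x @[x --> +oo] --> +oo.
Proof.
have [X X0 gX] := linear_lower_bound (scale_g D) (scale_qy D); apply/cvgryPge => A; near=> x.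
have Xx : X <= x by near: x; apply: nbhs_pinfty_ge; exact: num_real.
apply: le_trans (gX _ Xx); rewrite -lerBlDl lerBrDr.
by near: x; apply: nbhs_pinfty_ge; exact: num_real.
Unshelve. all: by end_near. Qed.

(** The equation [L psi = - lam psi], solved for the second derivative. The bound [M] excludes the
    solutions that grow like the scale function. *)
Record eigen (M lam : R) (psi dpsi : R -> R) : Prop := Eigen {
  eigen_d1 : forall x, 0 < x -> is_derive x 1 psi (dpsi x) ;
  eigen_d2 : forall x, 0 < x ->
    is_derive x 1 dpsi (2 * q x * dpsi x - 2 * lam * psi x) ;
  eigen_bnd : forall x, 0 < x -> `|psi x| <= M }.

Lemma eigenN M lam psi dpsi : eigen M lam psi dpsi ->
  eigen M lam (fun x => - psi x) (fun x => - dpsi x).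
Proof.
case=> d1 d2 bd; split=> x x0.
- exact/is_derive1N/d1.
- by derive; ring.
- by rewrite normrN bd.
Qed.

(** The factor [e^-g] puts the equation in divergence form: the drift term cancels. *)
Lemma is_derive_eigen_flux M lam psi dpsi x : eigen M lam psi dpsi -> 0 < x ->
  is_derive x 1 (fun y => expR (- g y) * dpsi y) (- (2 * lam * expR (- g x) * psi x)).
Proof.
case=> d1 d2 bd x0.
by derive; ring.
Qed.

(* Otherwise [psi' >= eps e^g] near infinity, and [psi] would be unbounded. *)
Lemma eigen_flux_le M lam psi dpsi x : 0 <= lam -> eigen M lam psi dpsi -> 0 < x ->
  expR (- g x) * dpsi x <= 2 * lam * M * J x.
Proof.
move=> lam0 E x0; rewrite leNgt; apply/negP; rewrite -subr_gt0.
set eps := (X in 0 < X) => eps0.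
(* By [|psi| <= M] the flux minus [2 lam M J] is nondecreasing, so an excess [eps] at [x] persists
   to the right. *)
have xe y : x <= y -> eps <= expR (- g y) * dpsi y - 2 * lam * M * J y.
  move=> xy; apply: (@ge0_derive_le _
    (fun y => expR (- g y) * dpsi y - 2 * lam * M * J y)
    (fun y => 2 * lam * expR (- g y) * (M - psi y))) => // z xz _.
    have z0 : 0 < z by exact: lt_le_trans xz.
    have dflux := is_derive_eigen_flux E z0.
    have dJ := is_derive1M (is_derive1_cst (2 * lam * M) z) (DJ z0).
    by apply: (is_derive1_eq (is_derive1D dflux (is_derive1N dJ))); ring.
  rewrite mulr_ge0//; first by rewrite !mulr_ge0// expR_ge0.
  rewrite subr_ge0 (le_trans (ler_norm _))// (eigen_bnd E)//; exact: lt_le_trans xz.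
have /cvgryPge/(_ 0)[X [_ gX]] := scale_gy.
pose Y := Num.max x (X + 1).
have xY : x <= Y by rewrite le_max lexx.
have Y0 : 0 < Y by exact: lt_le_trans xY.
have M0 : 0 <= M by rewrite (le_trans _ (eigen_bnd E Y0)).
have dY y : Y <= y -> eps <= dpsi y.
  move=> Yy; have y0 : 0 < y by exact: lt_le_trans Yy.
  have : eps <= expR (- g y) * dpsi y.
    apply: le_trans (xe y _) _; first exact: le_trans Yy.
    by rewrite gerBl !mulr_ge0// scale_J_ge0.
  rewrite expRN -ler_pdivrMl ?invr_gt0 ?expR_gt0// invrK; apply: le_trans.
  apply: ler_peMl; first exact: ltW.
  rewrite -expR0 ler_expR; apply: gX.
  by apply: lt_le_trans Yy; rewrite /Y lt_max ltrDl ltr01 orbT.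
(* Over this length a slope of at least [eps] raises [psi] by [2 M + 1], more than the width [2 M]
   that [|psi| <= M] allows. *)
pose y := Y + (2 * M + 1) / eps.
have Yy : Y <= y by rewrite lerDl divr_ge0// ?ltW//; lra.
have : psi Y - eps * Y <= psi y - eps * y.
  apply: (@ge0_derive_le _ (fun y => psi y - eps * y) (fun y => dpsi y - eps)) => //.
    move=> z Yz _; have z0 := lt_le_trans Y0 Yz; have d1 := eigen_d1 E.
    by derive; ring.
  by move=> z Yz _; rewrite subr_ge0 dY.
have -> : eps * y = eps * Y + 2 * M + 1.
  by rewrite /y mulrDr mulrCA divff ?gt_eqF// mulr1 addrA.
have := eigen_bnd E Y0; have := eigen_bnd E (lt_le_trans Y0 Yy).
by rewrite !ler_norml; lra.
Qed.

Lemma eigen_flux_norm_le M lam psi dpsi x : 0 <= lam -> eigen M lam psi dpsi ->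
  0 < x -> `|expR (- g x) * dpsi x| <= 2 * lam * M * J x.
Proof.
move=> lam0 E x0; rewrite ler_norml (eigen_flux_le _ E)// andbT lerNl -mulrN.
exact: (eigen_flux_le _ (eigenN E)).
Qed.

End scale.

(** * Bessel's inequality for the eigenfunctions *)

Section bessel.
Set Implicit Arguments.
Unset Strict Implicit.
Context {R : realType}.
Variables (q g J H La : R -> R).
Implicit Types x y z X M lam : R.
Hypothesis D : scale_data q g J H La.
Let Dg := scale_g D.
Let DJ := scale_J D.
Let DH := scale_H D.
Let DLa := scale_La D.

Lemma norm_le_cvg0 {T : Type} (F : set_system T) {FF : Filter F} (f u : T -> R) :
  (\forall x \near F, `|f x| <= u x) -> u x @[x --> F] --> 0 -> f x @[x --> F] --> 0.
Proof.
move=> fu u0; apply: (@squeeze_cvgr _ _ _ _ (fun x : T => - u x) u) => //.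
  by apply: filterS fu => x; rewrite ler_norml.
by rewrite -oppr0; exact: cvgN.
Qed.

Lemma cvg_sum_ord {T : Type} n (F : set_system T) {FF : Filter F} (f : 'I_n -> T -> R)
    (l : 'I_n -> R) :
  (forall k, f k x @[x --> F] --> l k) ->
  \sum_(k < n) f k x @[x --> F] --> \sum_(k < n) l k.
Proof.
elim: n => [|n ih] in f l * => fl.
  rewrite big_ord0 (_ : (fun x : T => \sum_(k < 0) f k x) = fun=> 0); first exact: cvg_cst.
  by apply/funext => x; rewrite big_ord0.
rewrite big_ord_recr/= (_ : (fun x : T => \sum_(k < n.+1) f k x) =
    fun x : T => \sum_(k < n) f (widen_ord (leqnSn n) k) x + f ord_max x).
  by apply: cvgD => //; exact: ih.
by apply/funext => x; rewrite big_ord_recr.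
Qed.

(* [2 Psi(x)] is twice the inner product of [Psi'] with [e^g 1_[0,x]] in
   [L^2(e^-g)]; the square of the norm of the latter is [La x], that of [Psi']
   is [N]. *)
Lemma double_le_scale_energy M C N (Psi dPsi F K : R -> R) :
  (forall x, 0 < x -> is_derive x 1 Psi (dPsi x)) ->
  (forall x, 0 < x -> is_derive x 1 dPsi (2 * q x * dPsi x - 2 * F x)) ->
  (forall x, 0 < x -> `|Psi x| <= M) ->
  (forall x, 0 < x -> `|expR (- g x) * dPsi x| <= C * J x) ->
  Psi x @[x --> 0^'+] --> 0 ->
  (forall x, 0 < x -> is_derive x 1 K (2 * expR (- g x) * (Psi x * F x))) ->
  K x @[x --> 0^'+] --> 0 -> K x @[x --> +oo] --> N ->
  forall x, 0 < x -> 2 * Psi x <= La x + N.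
Proof.
move=> DPsi DdPsi PsiM dPsiC Psi0 DK K0 KN x x0.
(* By parts, [A] is the energy of [Psi] accumulated from 0: the derivative of the flux contributes
   [- 2 e^-g Psi F], which [K] compensates, and the flux bound kills the boundary terms. *)
pose A y := Psi y * (expR (- g y) * dPsi y) + K y.
have DA y : 0 < y -> is_derive y 1 A (expR (- g y) * dPsi y ^+ 2).
  by move=> y0; rewrite /A; derive; ring.
have AN : A x <= N.
  apply: (@ge0_derive_le_limy _ A (fun y => expR (- g y) * dPsi y ^+ 2)).
  - by move=> z xz; apply: DA; exact: lt_le_trans xz.
  - by move=> z xz; rewrite mulr_ge0 ?expR_ge0 ?sqr_ge0.
  rewrite -[N]add0r; apply: cvgD => //.
  apply: (@norm_le_cvg0 _ _ _ _ (fun y => M * C * J y)); last first.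
    by rewrite -[X in _ --> X](mulr0 (M * C)); apply: cvgMr; exact: scale_Jy D.
  near=> y; have y0 : 0 < y by near: y; apply: nbhs_pinfty_gt; exact: num_real.
  by rewrite normrM -mulrA ler_pM// ?PsiM// dPsiC.
suff : 0 <= La x - 2 * Psi x + A x by lra.
(* The integrand of the squared distance from [Psi'] to [e^g] in [L^2(e^-g)]; it is the derivative
   of [La - 2 Psi + A]. *)
pose dG y := expR (- g y) * (expR (g y) - dPsi y) ^+ 2.
apply: (@ge0_derive_lim0_le _ (fun y => La y - 2 * Psi y + A y) dG) => //.
- move=> z z0; rewrite /dG; derive.
  have eg : expR (- g z) * expR (g z) = 1 by rewrite -expRD addNr expR0.
  by ring: eg.
- by move=> z z0; rewrite mulr_ge0 ?expR_ge0 ?sqr_ge0.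
rewrite -[X in _ --> X]addr0; apply: cvgD.
  have e : 0 - 2 * 0 = 0 :> R by ring.
  rewrite -[X in _ --> X]e; apply: cvgB; first exact: scale_La0 D.
  exact: cvgMr.
rewrite -[X in _ --> X]addr0; apply: cvgD => //.
apply: (@norm_le_cvg0 _ _ _ _ (fun y => `|Psi y| * (C * J y))); last first.
  rewrite -[X in _ --> X](mul0r (C * J 0)); apply: cvgM.
    by rewrite -[X in _ --> X](@normr0 R R); exact: cvg_norm.
  by apply: cvgMr; exact: scale_J0 D.
near=> y; have y0 : 0 < y by near: y; exact: nbhs_right_gt.
by rewrite normrM ler_wpM2l// dPsiC.
Unshelve. all: by end_near. Qed.

Variables (lam M : nat -> R) (psi dpsi : nat -> R -> R).
Hypothesis lam_gt0 : forall k, 0 < lam k.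
Hypothesis psiE : forall k, eigen q (M k) (lam k) (psi k) (dpsi k).
Hypothesis psi0 : forall k, psi k x @[x --> 0^'+] --> 0.

(* [K] stands for the primitive vanishing at 0; the last assumption is the
   orthonormality of the family [psi]. *)
Hypothesis psi_ortho : forall i j, exists K : R -> R,
  [/\ forall x, 0 < x -> is_derive x 1 K (2 * expR (- g x) * (psi i x * psi j x)),
      K x @[x --> 0^'+] --> 0 & K x @[x --> +oo] --> ((i == j)%:R : R)].

(** Supplies the [K] of [double_le_scale_energy] for a finite combination of eigenfunctions:
    orthonormality removes the cross terms, so the energy is diagonal in the coefficients. *)
Lemma psi_energy_primitive n (c : nat -> R) : exists K : R -> R,
  [/\ forall x, 0 < x -> is_derive x 1 K
        (2 * expR (- g x) * ((\sum_(i < n) c i * psi i x) *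
                             (\sum_(j < n) c j * lam j * psi j x))),
      K x @[x --> 0^'+] --> 0 & K x @[x --> +oo] --> \sum_(i < n) lam i * c i ^+ 2].
Proof.
have [K2' HK'] := choice (fun ij => psi_ortho ij.1 ij.2).
pose K2 i j := K2' (i, j); have HK i j := HK' (i, j).
exists (fun x => \sum_(i < n) \sum_(j < n) c i * (c j * lam j) * K2 i j x); split.
- move=> x x0.
  pose f i j := c i * (c j * lam j) * (2 * expR (- g x) * (psi i x * psi j x)).
  apply: (@is_derive1_eq _ _ _ (\sum_(i < n) \sum_(j < n) f i j)).
    apply: is_derive1_sum => i; apply: is_derive1_sum => j.
    have [DK _ _] := HK i j.
    by rewrite /f; derive; ring.
  rewrite mulr_suml mulr_sumr; apply: eq_bigr => i _.
  by rewrite mulr_sumr mulr_sumr; apply: eq_bigr => j _; rewrite /f; ring.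
- rewrite -[X in _ --> X](_ : \sum_(i < n) \sum_(j < n) c i * (c j * lam j) * 0 = 0).
    apply: cvg_sum_ord => i; apply: cvg_sum_ord => j; apply: cvgMr.
    by have [] := HK i j.
  by rewrite big1// => i _; rewrite big1// => j _; rewrite mulr0.
- rewrite [X in _ --> X](_ : _ = \sum_(i < n) \sum_(j < n) c i * (c j * lam j) * (nat_of_ord i == nat_of_ord j)%:R).
    apply: cvg_sum_ord => i; apply: cvg_sum_ord => j; apply: cvgMr.
    by have [] := HK i j.
  apply: eq_bigr => i _; rewrite (bigD1 i)//= eqxx mulr1 big1 ?addr0; first by ring.
  by move=> j ji; rewrite eq_sym -val_eqE/= in ji *; rewrite (negbTE ji) mulr0.
Qed.

Lemma psi_bessel n x : 0 < x -> \sum_(k < n) psi k x ^+ 2 / lam k <= La x.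
Proof.
(* With these coefficients, taken at the fixed point [x], the value of the combination at [x] and
   its energy are the same number [S], so the inequality reads [2 S <= La x + S]. *)
move=> x0; pose c k := psi k x / lam k.
have [K [DK K0 KN]] := psi_energy_primitive n c.
have -> : \sum_(k < n) psi k x ^+ 2 / lam k = \sum_(k < n) c k * psi k x.
  by apply: eq_bigr => k _; rewrite /c expr2; ring.
have NE : \sum_(i < n) lam i * c i ^+ 2 = \sum_(k < n) c k * psi k x.
  by apply: eq_bigr => k _; rewrite /c; field; rewrite gt_eqF.
suff : 2 * \sum_(k < n) c k * psi k x <=
    La x + \sum_(i < n) lam i * c i ^+ 2 by rewrite NE; lra.
apply: (@double_le_scale_energy (\sum_(k < n) `|c k| * M k)
  (\sum_(k < n) `|c k| * (2 * lam k * M k)) _ (fun y => \sum_(k < n) c k * psi k y)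
  (fun y => \sum_(k < n) c k * dpsi k y)
  (fun y => \sum_(k < n) c k * lam k * psi k y) K) => //.
- move=> y y0; apply: is_derive1_sum => k; have d1 := eigen_d1 (psiE k).
  by derive; ring.
- move=> y y0; apply: (@is_derive1_eq _ _ _ (\sum_(k < n)
    c k * (2 * q y * dpsi k y - 2 * lam k * psi k y))).
    apply: is_derive1_sum => k; have d2 := eigen_d2 (psiE k).
    by derive; ring.
  by rewrite !mulr_sumr -sumrB; apply: eq_bigr => k _; ring.
- move=> y y0; rewrite (le_trans (ler_norm_sum _ _ _))// ler_sum// => k _.
  by rewrite normrM ler_wpM2l// (eigen_bnd (psiE k)).
- move=> y y0; rewrite mulr_sumr mulr_suml (le_trans (ler_norm_sum _ _ _))//.
  apply: ler_sum => k _.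
  rewrite [expR _ * _]mulrCA normrM -[leRHS]mulrA; apply: ler_wpM2l => //.
  exact: (eigen_flux_norm_le D (ltW (lam_gt0 k)) (psiE k)).
- rewrite -[X in _ --> X](_ : \sum_(i < n) c i * 0 = 0).
    by apply: cvg_sum_ord => i; exact: cvgMr.
  by rewrite big1// => i _; rewrite mulr0.
Qed.

Lemma psi_sqr_le k x : 0 < x -> psi k x ^+ 2 <= lam k * La x.
Proof.
move=> x0; rewrite -ler_pdivrMl// mulrC; apply: le_trans (psi_bessel k.+1 x0).
rewrite big_ord_recr/= lerDr sumr_ge0// => i _.
by rewrite divr_ge0 ?sqr_ge0// ltW.
Qed.

(** Bessel's inequality integrated against [mu]: each [psi k ^+ 2] has integral 1, and exchanging
    the order of integration turns the integral of [La] into [2 H 0]. *)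
Lemma sum_inv_lam_le n : \sum_(k < n) (lam k)^-1 <= 2 * H 0.
Proof.
have [K2' HK'] := choice (fun ij => psi_ortho ij.1 ij.2).
pose K2 i j := K2' (i, j); have HK i j := HK' (i, j).
pose T x := \sum_(k < n) (lam k)^-1 * K2 k k x.
pose S x := \sum_(k < n) psi k x ^+ 2 / lam k.
have DT x : 0 < x -> is_derive x 1 T (2 * expR (- g x) * S x).
  move=> x0; apply: (@is_derive1_eq _ _ _ (\sum_(k < n)
      (lam k)^-1 * (2 * expR (- g x) * (psi k x * psi k x)))).
    apply: is_derive1_sum => k; have [DK _ _] := HK k k.
    by derive; ring.
  by rewrite mulr_sumr; apply: eq_bigr => k _; ring.
have T0 : T x @[x --> 0^'+] --> 0.
  rewrite -[X in _ --> X](_ : \sum_(i < n) (lam i)^-1 * 0 = 0).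
    by apply: cvg_sum_ord => i; apply: cvgMr; have [] := HK i i.
  by rewrite big1// => i _; rewrite mulr0.
have Ty : T x @[x --> +oo] --> \sum_(k < n) (lam k)^-1.
  rewrite -[X in _ --> X](_ : \sum_(i < n) (lam i)^-1 * (i == i)%:R = _).
    by apply: cvg_sum_ord => i; apply: cvgMr; have [] := HK i i.
  by apply: eq_bigr => i _; rewrite eqxx mulr1.
apply: (cvgr_to_le Ty); near=> x.
have x0 : 0 < x by near: x; apply: nbhs_pinfty_gt; exact: num_real.
(* The terms in [H] and [La J] are the integral of [La] against [mu] done by parts, with [La J] as
   boundary term; this leaves [La - S] as the only factor of undetermined sign in the derivative. *)
pose G y := - (2 * H y + 2 * (La y * J y) + T y).
pose dG y := 2 * expR (- g y) * (La y - S y).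
have Glim : G y @[y --> 0^'+] --> - (2 * H 0).
  apply: cvgN; rewrite -[X in _ --> X]addr0; apply: cvgD => //.
  rewrite -[X in _ --> X]addr0; apply: cvgD; first by apply: cvgMr; exact: scale_H0 D.
  have e : 2 * (0 * J 0) = 0 by ring.
  rewrite -[X in _ --> X]e.
  by apply: cvgMr; apply: cvgM; [exact: scale_La0 D|exact: scale_J0 D].
have : - (2 * H 0) <= G x.
  apply: (@ge0_derive_lim0_le _ G dG) => //.
  - move=> z z0; rewrite /G /dG; derive; ring.
  - move=> z z0; rewrite mulr_ge0 ?mulr_ge0 ?expR_ge0// subr_ge0.
    exact: psi_bessel.
rewrite /G; have := scale_H_ge0 D x0.
have : 0 <= La x * J x by rewrite mulr_ge0 ?(scale_J_ge0 D)// (scale_La_ge0 D).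
lra.
Unshelve. all: by end_near. Qed.

End bessel.

(** * Growth of the eigenfunctions *)

Section eigen_growth.
Set Implicit Arguments.
Unset Strict Implicit.
Context {R : realType}.
Variables (q g J H La : R -> R).
Implicit Types x y z X M lam : R.
Hypothesis D : scale_data q g J H La.
Let Dg := scale_g D.
Let DJ := scale_J D.
Let DH := scale_H D.
Let DLa := scale_La D.
Let h x := expR (g x) * J x.

Lemma expRNM x : expR (- g x) * expR (g x) = 1.
Proof. by rewrite -expRD addNr expR0. Qed.

(* [psi w - 4 lam J psi^2] is nondecreasing with limit 0, hence nonpositive,
   i.e. [psi psi' <= 4 lam h psi^2]. *)
Lemma eigen_sqr_le M lam psi dpsi x y : 0 <= lam -> eigen q M lam psi dpsi ->
  0 < x -> (forall z, x <= z -> 8 * lam * h z ^+ 2 <= 1) -> x <= y ->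
  psi y ^+ 2 <= psi x ^+ 2 * expR (8 * lam * H x).
Proof.
move=> lam0 E x0 hx xy.
have d1 := eigen_d1 E; have d2 := eigen_d2 E.
have M0 : 0 <= M by rewrite (le_trans _ (eigen_bnd E x0)).
pose Phi z := psi z * (expR (- g z) * dpsi z) - 4 * lam * (J z * psi z ^+ 2).
(* Completing the square in [psi'] costs [16 lam^2 h^2 psi^2]; the term [2 lam psi^2] absorbs it
   exactly when [8 lam h^2 <= 1]. *)
pose dPhi z := expR (- g z) * ((dpsi z - 4 * lam * h z * psi z) ^+ 2 +
  2 * lam * psi z ^+ 2 * (1 - 8 * lam * h z ^+ 2)).
have DPhi z : 0 < z -> is_derive z 1 Phi (dPhi z).
  move=> z0; rewrite /Phi /dPhi /h; have eg := expRNM z.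
  under eq_fun do rewrite expr2.
  by derive; ring: eg.
have Phiy : Phi z @[z --> +oo] --> 0.
  apply: (@norm_le_cvg0 _ _ _ _ _ (fun z => 6 * lam * M ^+ 2 * J z)); last first.
    rewrite -[X in _ --> X](mulr0 (6 * lam * M ^+ 2)).
    by apply: cvgMr; exact: scale_Jy D.
  near=> z; have z0 : 0 < z by near: z; apply: nbhs_pinfty_gt; exact: num_real.
  have -> : 6 * lam * M ^+ 2 * J z = M * (2 * lam * M * J z) + 4 * lam * (J z * M ^+ 2).
    by ring.
  have J0 := scale_J_ge0 D z0; have bd := eigen_bnd E z0.
  rewrite (le_trans (ler_normB _ _))// lerD//.
    by rewrite normrM ler_pM// (eigen_flux_norm_le D lam0 E).
  rewrite normrM ger0_norm ?mulr_ge0// ler_wpM2l ?mulr_ge0//.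
  by rewrite normrM ger0_norm// ler_wpM2l// normrX lerXn2r ?nnegrE.
have Phi0 z : x <= z -> Phi z <= 0.
  move=> xz; apply: (@ge0_derive_le_limy _ Phi dPhi) Phiy.
    by move=> u zu; apply: DPhi; apply: lt_le_trans zu; exact: lt_le_trans xz.
  move=> u zu; rewrite mulr_ge0 ?expR_ge0// addr_ge0 ?sqr_ge0//.
  apply: mulr_ge0; first by rewrite mulr_ge0 ?sqr_ge0// mulr_ge0.
  by rewrite subr_ge0 hx// (le_trans xz).
(* Gronwall's argument: [H' = - h], so [psi psi' <= 4 lam h psi^2] makes [V] nonincreasing; at [y]
   the exponential factor is at least 1 and is dropped. *)
pose V z := psi z ^+ 2 * expR (8 * lam * H z).
have : V y <= V x.
  apply: (@le0_derive_ge _ V (fun z => 2 * expR (8 * lam * H z) * expR (g z) * Phi z)) => //.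
    move=> z xz _; have z0 : 0 < z by exact: lt_le_trans xz.
    rewrite /V /Phi; have eg := expRNM z.
    under eq_fun do rewrite expr2.
    by derive; ring: eg.
  move=> z xz _; rewrite mulr_ge0_le0 ?Phi0// !mulr_ge0 ?expR_ge0//.
apply: le_trans; rewrite /V ler_peMr ?sqr_ge0// -expR0 ler_expR.
by rewrite !mulr_ge0// (scale_H_ge0 D)// (lt_le_trans x0).
Unshelve. all: by end_near. Qed.

Variables (a x0 : R).
Hypothesis a_gt0 : 0 < a.
Hypothesis qH3 : forall x, x0 <= x -> forall y, x <= y -> a * q x <= q y.

(** By (H3), [q >= a q(x)] on the whole tail, so [e^-g] decays there at rate at least [2 a q(x)] and
    its tail integral [J] is at most [e^-g / (2 a q(x))]. *)
Lemma scale_h_le x y : 0 < x -> x0 <= x -> 0 < q x -> x <= y ->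
  2 * a * q x * h y <= 1.
Proof.
move=> xp x0x qx xy.
have yp : 0 < y by exact: lt_le_trans xy.
suff : 2 * a * q x * J y - expR (- g y) <= 0.
  rewrite subr_le0 => cJ.
  have -> : 2 * a * q x * h y = 2 * a * q x * J y * expR (g y) by rewrite /h; ring.
  by rewrite -[leRHS](expRNM y) ler_wpM2r// expR_ge0.
apply: (@ge0_derive_le_limy _ (fun y => 2 * a * q x * J y - expR (- g y))
   (fun z => 2 * expR (- g z) * (q z - a * q x))).
- by move=> z yz; have z0 := lt_le_trans yp yz; derive; ring.
- move=> z yz; rewrite !mulr_ge0 ?expR_ge0// subr_ge0 qH3// (le_trans xy)//.
- have e : 2 * a * q x * 0 - 0 = 0 by ring.
  rewrite -[X in _ --> X]e; apply: cvgB; first by apply: cvgMr; exact: scale_Jy D.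
  exact: cvg_comp (scale_gy D) (@cvgr_expR R).
Qed.

(** Since [h' = 2 q h - 1], the length [x - X] is at most [h X] plus the integral of [2 q h] over
    [[X, x]]. (H3) read backwards gives [q <= q(x) / a] there, and the integral of [h] is at most
    [H X]. As [H X] can be made small, [x = o(q(x))]. *)
Lemma scale_x_le X x : 0 < X -> x0 <= X -> 0 < q X -> X <= x ->
  x <= X + (2 * a * q X)^-1 + 2 / a * q x * H X.
Proof.
move=> Xp x0X qX Xx.
have hX : h X <= (2 * a * q X)^-1.
  by rewrite -[leRHS]mulr1 -ler_pdivrMl ?invr_gt0 ?mulr_gt0// invrK scale_h_le.
have xp : 0 < x by exact: lt_le_trans Xx.
have qQ z : X <= z -> z <= x -> q z <= q x / a.
  move=> Xz zx; rewrite ler_pdivlMr// mulrC; apply: qH3 => //.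
  exact: le_trans Xz.
suff : h x + 2 * (q x / a) * H x + x <= h X + 2 * (q x / a) * H X + X.
  have : 0 <= h x by rewrite mulr_ge0 ?expR_ge0// (scale_J_ge0 D).
  have : 0 <= 2 * (q x / a) * H x.
    rewrite !mulr_ge0 ?invr_ge0 ?(ltW a_gt0) ?(scale_H_ge0 D)//.
    by apply: le_trans (qH3 x0X Xx); rewrite mulr_ge0 ?ltW.
  have -> : 2 * (q x / a) * H X = 2 / a * q x * H X by ring.
  lra.
rewrite /h.
apply: (@le0_derive_ge _ (fun z => expR (g z) * J z + 2 * (q x / a) * H z + z)
  (fun z => 2 * (q z - q x / a) * (expR (g z) * J z))) => //.
  move=> z Xz _; have z0 : 0 < z by exact: lt_le_trans Xz.
  by have eg := expRNM z; derive; ring: eg.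
move=> z Xz zx; have z0 : 0 < z by exact: lt_le_trans Xz.
rewrite mulr_le0_ge0 ?mulr_ge0 ?expR_ge0 ?(scale_J_ge0 D)//.
by rewrite mulr_ge0_le0// subr_le0 qQ.
Qed.

Lemma scale_g_le X x : 0 < X -> x0 <= X -> X <= x -> g x <= g X + 2 / a * q x * (x - X).
Proof.
move=> Xp x0X Xx.
suff : g x - 2 * (q x / a) * x <= g X - 2 * (q x / a) * X.
  have -> : 2 / a * q x * (x - X) = 2 * (q x / a) * x - 2 * (q x / a) * X by ring.
  lra.
apply: (@le0_derive_ge _ (fun z => g z - 2 * (q x / a) * z)
  (fun z => 2 * (q z - q x / a))) => //.
  by move=> z Xz _; have z0 : 0 < z by [exact: lt_le_trans Xz|]; derive; ring.
move=> z Xz zx; rewrite mulr_ge0_le0// subr_le0 ler_pdivlMr// mulrC.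
by apply: qH3 => //; exact: le_trans Xz.
Qed.

(** Combines [h = O(1/q)] with [g(x) = O(x q(x))] and [x = o(q(x))]. The bound covers all [y >= x]
    because [eigen_sqr_le] requires its smallness condition on a whole tail. *)
Lemma scale_sqr_h_g_small (eps : R) : 0 < eps ->
  \forall x \near +oo, forall y, x <= y -> h y ^+ 2 * g x <= eps.
Proof.
move=> eps0.
(* [x <= k q(x)] eventually, whence [g(x) <= k (1 + 2 / a) q(x)^2] *)
have a21 : 0 < 1 + 2 / a by rewrite addr_gt0// divr_gt0.
(* This [k] turns [h^2 k (1 + 2 / a) q^2] into [eps (2 a q h)^2], which [scale_h_le] bounds by
   [eps]. *)
have [k k0 ke] : exists2 k : R, 0 < k & k * (1 + 2 / a) = eps * (4 * a ^+ 2).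
  exists (eps * (4 * a ^+ 2) / (1 + 2 / a)); last by rewrite divfK// gt_eqF.
  by rewrite divr_gt0// mulr_gt0// mulr_gt0// exprn_gt0.
pose X0 := Num.max x0 1.
have X01 : 0 < X0 by rewrite lt_max ltr01 orbT.
have x0X0 : x0 <= X0 by rewrite le_max lexx.
(* Half of [k] pays for the term in [H X] of [scale_x_le]; the other half absorbs the constant terms
   once [q x] is large. *)
have [X [XX0 qX HX]] : exists X, [/\ X0 <= X, 1 <= q X & 2 / a * H X <= k / 2].
  have kpos : 0 < k / 2 / (2 / a) by rewrite !divr_gt0.
  near (pinfty_nbhs R) => X; exists X; split.
  - by near: X; apply: nbhs_pinfty_ge; exact: num_real.
  - by near: X; have /cvgryPge := scale_qy D; exact.
  - rewrite mulrC -ler_pdivlMr ?divr_gt0//.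
    near: X; have /cvgr0Pnorm_le/(_ _ kpos) := scale_Hy D.
    by apply: filterS => z; apply: le_trans; exact: ler_norm.
have Xp : 0 < X by exact: lt_le_trans XX0.
have x0X : x0 <= X by exact: le_trans XX0.
have qXp : 0 < q X by exact: lt_le_trans qX.
near=> x => y xy.
have Xx : X <= x by near: x; apply: nbhs_pinfty_ge; exact: num_real.
have xp : 0 < x by exact: lt_le_trans Xx.
have qx1 : 1 <= q x by near: x; have /cvgryPge := scale_qy D; exact.
have qx2 : 2 / k * (X + (2 * a * q X)^-1) <= q x.
  by near: x; have /cvgryPge := scale_qy D; exact.
have qx3 : g X / k <= q x by near: x; have /cvgryPge := scale_qy D; exact.
have qxp : 0 < q x by exact: lt_le_trans qx1.
have xkq : x <= k * q x.
  apply: le_trans (scale_x_le Xp x0X qXp Xx) _.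
  have : X + (2 * a * q X)^-1 <= k / 2 * q x.
    by rewrite -ler_pdivrMl ?divr_gt0// invf_div.
  have : 2 / a * q x * H X <= k / 2 * q x by rewrite mulrAC ler_wpM2r// ltW.
  lra.
have gX : g X <= k * q x ^+ 2.
  have : g X <= k * q x by rewrite mulrC -ler_pdivrMr.
  by move=> /le_trans; apply; rewrite ler_wpM2l ?(ltW k0)// expr2 ler_peMr// ltW.
have gx : g x <= k * (1 + 2 / a) * q x ^+ 2.
  apply: le_trans (scale_g_le Xp x0X Xx) _.
  have -> : k * (1 + 2 / a) * q x ^+ 2 = k * q x ^+ 2 + 2 / a * q x * (k * q x) by ring.
  apply: lerD => //.
  apply: ler_wpM2l; first by rewrite mulr_ge0 ?divr_ge0// ltW.
  by apply: le_trans xkq; rewrite gerBl ltW.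
have y0 : 0 < y by exact: lt_le_trans xy.
have h0 : 0 <= h y by rewrite mulr_ge0 ?expR_ge0 ?(scale_J_ge0 D).
have hy : 2 * a * q x * h y <= 1 by exact: scale_h_le xp (le_trans x0X Xx) qxp xy.
have : (2 * a * q x * h y) ^+ 2 <= 1.
  by rewrite exprn_ile1// mulr_ge0// ltW// !mulr_gt0.
have : h y ^+ 2 * g x <= h y ^+ 2 * (k * (1 + 2 / a) * q x ^+ 2).
  by rewrite ler_wpM2l ?sqr_ge0.
have -> : h y ^+ 2 * (k * (1 + 2 / a) * q x ^+ 2) = eps * (2 * a * q x * h y) ^+ 2.
  by rewrite ke; ring.
move=> /le_trans + /(ler_wpM2l (ltW eps0)); rewrite mulr1; exact.
Unshelve. all: by end_near. Qed.

(** The 9 is 1 + 8: one [delta lam] for [La] up to the gluing point, eight for the factor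
    [e^(8 lam H)] beyond it, where [H <= delta]. The constant depends on [delta] only through [X],
    hence is common to all eigenfunctions. *)
Lemma eigen_sup_bound (delta : R) : 0 < delta -> exists2 C, 0 < C &
  forall M lam psi dpsi, 0 < lam -> eigen q M lam psi dpsi ->
  (forall x, 0 < x -> psi x ^+ 2 <= lam * La x) ->
  forall x, 0 < x -> psi x ^+ 2 <= C * lam * expR (9 * delta * lam).
Proof.
move=> d0.
have [X [X0 qX gX HX hX]] : exists X, [/\ 0 < X, forall x, X <= x -> 1 <= q x,
    forall x, X <= x -> 0 <= g x, forall x, X <= x -> H x <= delta &
    forall x, X <= x -> forall y, x <= y -> h y ^+ 2 * g x <= delta / 8].
  have d8 : 0 < delta / 8 by rewrite divr_gt0.
  have [X1 [_ HX1]] := scale_sqr_h_g_small d8.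
  have /cvgryPge/(_ 1)[X2 [_ HX2]] := scale_qy D.
  have /cvgryPge/(_ 0)[X3 [_ HX3]] := scale_gy D.
  have /cvgr0Pnorm_le/(_ _ d0)[X4 [_ HX4]] := scale_Hy D.
  pose X := Num.max 0 (Num.max X1 (Num.max X2 (Num.max X3 X4))).
  have XX : [/\ 0 <= X, X1 <= X, X2 <= X, X3 <= X & X4 <= X].
    by rewrite /X !le_max !lexx !orbT.
  exists (X + 1); case: XX => X0 XX1 XX2 XX3 XX4; split => [|x Xx|x Xx|x Xx|x Xx].
  - lra.
  - by apply: HX2; lra.
  - by apply: HX3; lra.
  - by apply: le_trans (ler_norm _) _; apply: HX4; lra.
  - by apply: HX1; lra.
have gXi x : X <= x -> g X <= g x.
  move=> Xx; apply: (@ge0_derive_le _ g (fun z => 2 * q z)) => // z Xz _.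
    by apply: Dg; exact: lt_le_trans Xz.
  by have := qX _ Xz; lra.
exists ((La X + 1) * expR (g X)).
  by rewrite mulr_gt0 ?expR_gt0// ltr_wpDl// (scale_La_ge0 D).
move=> M lam psi dpsi lam0 E psiLa x xp.
(* [x1] is where [g] takes the value [delta lam], but never to the left of [X] *)
pose v := Num.max (g X) (delta * lam).
have [x1 Xx1 gx1] : exists2 x1, X <= x1 & g x1 = v.
  have [b [Xb vb]] : exists b, X <= b /\ v <= g b.
    near (pinfty_nbhs R) => b; exists b; split.
      by near: b; apply: nbhs_pinfty_ge; exact: num_real.
    by near: b; have /cvgryPge := scale_gy D; exact.
  have [||c] := @IVT R g X b v Xb.
  - apply: derivable_within_continuous => z; rewrite in_itv/= => /andP[Xz _].
    by have := Dg (lt_le_trans X0 Xz) => -[].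
  - apply/andP; split; first by rewrite ge_min /v le_max lexx.
    by apply: le_trans vb _; rewrite le_max lexx orbT.
  - by rewrite in_itv/= => /andP[Xc _] gc; exists c.
have x1p : 0 < x1 by exact: lt_le_trans Xx1.
have dv : delta * lam <= v by rewrite /v le_max lexx orbT.
(* The height of [g] at [x1] is at least [delta lam], which converts [h^2 g <= delta / 8] into the
   condition of the energy argument. *)
have h1 z : x1 <= z -> 8 * lam * h z ^+ 2 <= 1.
  move=> x1z; have := hX _ Xx1 _ x1z; rewrite gx1 => hz.
  have : h z ^+ 2 * (delta * lam) <= delta / 8.
    by apply: le_trans hz; rewrite ler_wpM2l ?sqr_ge0.
  have -> : h z ^+ 2 * (delta * lam) = 8 * lam * h z ^+ 2 * (delta / 8) by field.
  by rewrite ger_pMl ?divr_gt0.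
(* Beyond [X] one has [2 q >= 1], so [La] grows no faster than [e^g]. *)
have La1 : La x1 <= (La X + 1) * expR v.
  suff : La x1 - expR (g x1) <= La X - expR (g X).
    rewrite gx1 => e; have : La X <= La X * expR v.
      by rewrite ler_peMr ?(scale_La_ge0 D)// -expR0 ler_expR -gx1 gX.
    have := expR_ge0 (g X); lra.
  apply: (@le0_derive_ge _ (fun z => La z - expR (g z))
    (fun z => expR (g z) * (1 - 2 * q z))) => //.
    by move=> z Xz _; have z0 := lt_le_trans X0 Xz; derive; ring.
  move=> z Xz _; rewrite mulr_ge0_le0 ?expR_ge0//.
  by have := qX _ Xz; lra.
have ev : expR v <= expR (g X) * expR (delta * lam).
  rewrite -expRD ler_expR /v ge_max lerDl lerDr gX// andbT.
  by apply: mulr_ge0; exact: ltW.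
have psi1 z : 0 < z -> z <= x1 ->
    psi z ^+ 2 <= lam * ((La X + 1) * (expR (g X) * expR (delta * lam))).
  move=> z0 zx1; apply: le_trans (psiLa _ z0) _; rewrite ler_wpM2l ?(ltW lam0)//.
  apply: le_trans (scale_La_le D z0 zx1) _; apply: le_trans La1 _.
  by rewrite ler_wpM2l// addr_ge0// (scale_La_ge0 D).
have e9 : expR (9 * delta * lam) = expR (delta * lam) * expR (8 * lam * delta).
  by rewrite -expRD; congr expR; ring.
have -> : (La X + 1) * expR (g X) * lam * expR (9 * delta * lam) =
  lam * ((La X + 1) * (expR (g X) * expR (delta * lam))) * expR (8 * lam * delta).
  by rewrite e9; ring.
have [xx1|x1x] := leP x x1.
  apply: le_trans (psi1 _ xp xx1) _; rewrite ler_peMr//.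
    by apply: le_trans (psi1 _ xp xx1); exact: sqr_ge0.
  by rewrite -expR0 ler_expR !mulr_ge0 ?ltW.
apply: le_trans (eigen_sqr_le (ltW lam0) E x1p h1 (ltW x1x)) _.
apply: ler_pM; [exact: sqr_ge0|exact: expR_ge0|exact: psi1|].
by rewrite ler_expR ler_wpM2l ?HX// mulr_ge0 ?ltW.
Unshelve. all: by end_near. Qed.

End eigen_growth.

(** * Existence of the scale data *)

Section primitives.
Set Implicit Arguments.
Unset Strict Implicit.
Context {R : realType}.
Local Notation leb := (@lebesgue_measure R).
Implicit Types (f F : R -> R) (x y : R).

(** Freezing [f] at its value at 0 on the negative axis trades continuity within the half-line for
    continuity everywhere. *)
Lemma continuous_comp_max0 f : {within `[0%R, +oo[%classic, continuous f} ->
  continuous (fun x => f (Num.max 0 x)).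
Proof.
move=> /subspace_continuousP cf x.
have /cf : (`[0, +oo[%classic : set R) (Num.max 0 x).
  by rewrite /= in_itv/= andbT le_max lexx.
apply: cvg_comp => U /=; rewrite /within/= => xU.
have cmax : {for x, continuous (fun y : R => Num.max 0 y)}.
  by apply: continuous_max; [exact: cst_continuous|exact: cvg_id].
have max0 y : 0 <= Num.max 0 y by rewrite le_max lexx.
apply: (@filterS _ (nbhs x) _ _ _ _ (cmax _ xU)) => y /=; apply.
by rewrite /= in_itv/= andbT; exact: max0.
Qed.

Lemma continuous_itvcy f : (forall x, 0 <= x -> {for x, continuous f}) ->
  {within `[0%R, +oo[%classic, continuous f}.
Proof.
move=> cf; apply: continuous_in_subspaceT => x.
by rewrite inE/= in_itv/= andbT => /cf.
Qed.

Lemma continuous_integrable f a b : continuous f ->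
  leb.-integrable `[a, b] (EFin \o f).
Proof.
move=> cf; apply: continuous_compact_integrable; first exact: segment_compact.
exact: continuous_subspaceT.
Qed.

(* The interval starts at [-1] for [F] to be differentiable at [0]. *)
Lemma primitive f : continuous f -> exists F,
  [/\ forall x, -1 < x -> is_derive x 1 F (f x), F 0 = 0 &
      forall x, 0 <= x -> (\int[leb]_(y in `[0%R, x]) (f y)%:E = (F x)%:E)%E].
Proof.
move=> cf.
have [G [DG GE]] : exists G : R -> R, (forall x, -1 < x -> is_derive x 1 G (f x)) /\
    forall x, G x = Rintegral leb `[-1, x] f.
  exists (fun x => Rintegral leb `[-1, x] f); split=> // x x1.
  have [||/=dG] := @continuous_FTC1_closed R f (-1) x (x + 1) _ _ x1 (cf x).
  - by rewrite ltrDl.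
  - exact: continuous_integrable.
  - by rewrite derive1E; exact: DeriveDef.
exists (fun x => G x - G 0); split=> [x x1| |x x0].
- by derive; ring.
- by rewrite subrr.
- rewrite !GE Rintegral_itvB//; [|exact: continuous_integrable|by rewrite bnd_simp; lra..].
  rewrite Rintegral_itv_obnd_cbnd.
    by rewrite /Rintegral fineK// integrable_fin_num//; exact: continuous_integrable.
  apply: integrableS (continuous_integrable 0 x cf) => //.
  exact: subset_itv_oc_cc.
Qed.

Lemma primitive_bounded f F B : continuous f -> (forall x, 0 <= x -> 0 <= f x) ->
  (forall x, -1 < x -> is_derive x 1 F (f x)) -> (forall x, 0 <= x -> F x <= B) ->
  exists2 l : R, F x @[x --> +oo] --> l &
  forall y, 0 <= y -> (\int[leb]_(x in `[y, +oo[) (f x)%:E = (l - F y)%:E)%E.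
Proof.
move=> cf f0 DF FB.
have [l Fl] : exists l : R, F x @[x --> +oo] --> l.
  pose G x := F (Num.max 0 x); exists (sup (range G)).
  have : G x @[x --> +oo] --> sup (range G).
    apply: nondecreasing_cvgr.
      move=> x y xy; apply: (@ge0_derive_le _ F f).
      - by rewrite ge_max !le_max lexx xy orbT.
      - move=> z + _; rewrite ge_max => /andP[z0 _]; apply: DF; lra.
      - by move=> z + _; rewrite ge_max => /andP[z0 _]; exact: f0.
    by exists B => _ [x _ <-]; apply: FB; rewrite le_max lexx.
  apply: cvg_trans; apply: near_eq_cvg; near=> x.
  by rewrite /G max_r//; near: x; apply: nbhs_pinfty_ge; exact: num_real.
exists l => // y y0; rewrite EFinB.
apply: ge0_continuous_FTC2y => //.
- by move=> x yx; apply: f0; exact: le_trans yx.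
- exact: continuous_subspaceT.
- by move=> x yx; have [] := DF x (ltac:(lra)).
- apply: cvg_at_right_filter; apply: differentiable_continuous.
  by apply/derivable1_diffP; have [] := DF y (ltac:(lra)).
- move=> x; rewrite in_itv/= andbT => yx; rewrite derive1E.
  by have [_ ->] := DF x (ltac:(lra)).
Unshelve. all: by end_near. Qed.

(** For integrands of varying sign, such as [psi i * psi j], the primitive is not monotone; its
    limit comes from dominated convergence of truncations along sequences. *)
Lemma primitive_cvgy f F : continuous f ->
  leb.-integrable `[0, +oo[ (EFin \o f) ->
  (forall x, 0 <= x -> (\int[leb]_(y in `[0%R, x]) (f y)%:E = (F x)%:E)%E) ->
  F x @[x --> +oo] --> fine (\int[leb]_(x in `[0%R, +oo[) (f x)%:E)%E.
Proof.
move=> cf fi FE; apply/cvg_pinftyP => u uy.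
have intE : (\int[leb]_(x in `[0%R, +oo[) (f x)%:E)%E \is a fin_num.
  exact: integrable_fin_num.
suff /fine_cvg : (F (u n))%:E @[n --> \oo] -->
    (fine (\int[leb]_(x in `[0%R, +oo[) (f x)%:E)%E)%:E by [].
rewrite fineK//.
have : (\int[leb]_(x in `[0%R, +oo[) ((EFin \o f) \_ `[0%R, u n]) x)%E @[n --> \oo] -->
    (\int[leb]_(x in `[0%R, +oo[) (f x)%:E)%E.
  apply: (@dominated_cvg _ _ _ leb _ _ _ _ (fun x => `|(f x)%:E|%E)) => //.
  - move=> n; apply: measurable_funTS; apply/measurable_restrict => //.
    apply/measurable_EFinP.
    exact: measurable_funS (continuous_measurable_fun cf).
  - move=> x; rewrite /= in_itv/= andbT => x0.
    apply: cvg_near_cst; near=> n.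
    rewrite patchE mem_set//= in_itv/= x0/=.
    by near: n; have /cvgryPge := uy; exact.
  - exact: integrable_abse.
  - move=> n x _; rewrite patchE; case: ifPn => // _.
    by rewrite abse0 abse_ge0.
apply: cvg_trans; apply: near_eq_cvg; near=> n.
rewrite -integral_mkcondr setIidr.
  by rewrite -FE//; near: n; have /cvgryPge := uy; exact.
by move=> x /=; rewrite !in_itv/= => /andP[->].
Unshelve. all: by end_near. Qed.

End primitives.

Section scale_exists.
Set Implicit Arguments.
Unset Strict Implicit.
Context {R : realType}.
Local Notation leb := (@lebesgue_measure R).
Implicit Types (f q : R -> R) (x y : R).

Lemma C1_on_halfline_continuous q dq : C1_on_halfline q dq ->
  {within `[0, +oo[%classic, continuous q}.
Proof.
move=> [dqx [dq0 _]]; apply/continuous_within_itvcyP; split.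
  move=> x; rewrite in_itv/= andbT => x0; apply: differentiable_continuous.
  by apply/derivable1_diffP; have [] := dqx _ x0.
have : q 0 + x * ((q x - q 0) / x) @[x --> 0^'+] --> q 0 + 0 * dq 0.
  apply: cvgD; first exact: cvg_cst.
  by apply: cvgM => //; apply: cvg_at_right_filter; exact: cvg_id.
rewrite mul0r addr0; apply: cvg_trans; apply: near_eq_cvg; near=> x.
have x0 : 0 < x by near: x; exact: nbhs_right_gt.
by rewrite mulrC divfK ?gt_eqF// addrC subrK.
Unshelve. all: by end_near. Qed.

Lemma is_derive_continuous f df x : is_derive x 1 f df -> {for x, continuous f}.
Proof.
by case=> + _ => ?; apply: differentiable_continuous; exact/derivable1_diffP.
Qed.

Lemma cvg_at_right_derive f df x : is_derive x 1 f df -> f y @[y --> x^'+] --> f x.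
Proof. by move=> /is_derive_continuous ?; exact: cvg_at_right_filter. Qed.

Lemma derive_continuous_max0 f df : (forall x, -1 < x -> is_derive x 1 f (df x)) ->
  continuous (fun x => f (Num.max 0 x)).
Proof.
move=> Df; apply: continuous_comp_max0; apply: continuous_itvcy => x x0.
by apply: (is_derive_continuous (Df x _)); lra.
Qed.

Lemma scale_exists q dq : C1_on_halfline q dq -> H1 q -> H2 q dq ->
  exists g J H La : R -> R, [/\ scale_data q g J H La,
    forall x, 0 <= x -> gam q x = g x,
    forall x, 0 <= x -> {for x, continuous g} &
    (\int[leb]_(x in `[0%R, +oo[) (expR (- g x))%:E = (J 0)%:E)%E].
Proof.
move=> /C1_on_halfline_continuous/continuous_comp_max0 cq Hq [qy _].
have max0E x : 0 <= x -> Num.max 0 x = x by move=> x0; rewrite max_r.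
have c2q : continuous (fun x => 2 * q (Num.max 0 x)).
  by move=> x; apply: cvgM; [exact: cvg_cst|exact: cq].
have [Q [DQ Q0 QE]] := primitive cq.
have [g [Dg gE]] : exists g : R -> R,
    (forall x, -1 < x -> is_derive x 1 g (2 * q (Num.max 0 x))) /\
    forall x, 0 <= x -> gam q x = g x.
  exists (fun x => 2 * Q x); split=> [x x1|x x0]; first by derive; ring.
  rewrite /gam /Rintegral (_ : integral _ _ _ = (Q x)%:E)// -QE//.
  by apply: eq_integral => y; rewrite inE/= in_itv/= => /andP[y0 _]; rewrite max0E.
have Dg0 x : 0 < x -> is_derive x 1 g (2 * q x).
  by move=> x0; rewrite -[x in q x]max0E ?ltW//; apply: Dg; lra.
have cg := derive_continuous_max0 Dg.
have cexp f : continuous f -> continuous (fun x => expR (f x)).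
  by move=> cf x; apply: continuous_comp; [exact: cf|exact: continuous_expR].
have ce : continuous (fun x => expR (- g (Num.max 0 x))).
  by apply: cexp => x; apply: cvgN; exact: cg.
have [P1 [DP1 P10 P1E]] := primitive ce.
(* Past [X] the exponential of the linear bound decreases at least as fast as [P1] increases, so
   their sum is nonincreasing. *)
have [B P1B] : exists B, forall x, 0 <= x -> P1 x <= B.
  have [X X0 gX] := linear_lower_bound Dg0 qy.
  exists (P1 X + expR (- g X)) => x x0.
  have [xX|Xx] := leP x X.
    rewrite (@le_trans _ _ (P1 X))// ?lerDl ?expR_ge0//.
    apply: (ge0_derive_le xX (df := fun x => expR (- g (Num.max 0 x)))) => z xz _.
      by apply: DP1; lra.
    exact: expR_ge0.
  suff : P1 x + expR (- (g X + (x - X))) <= P1 X + expR (- (g X + (X - X))).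
    by rewrite subrr addr0; have := expR_ge0 (- (g X + (x - X))); lra.
  apply: (@le0_derive_ge _ (fun x => P1 x + expR (- (g X + (x - X))))
    (fun x => expR (- g (Num.max 0 x)) - expR (- (g X + (x - X)))) _ _ (ltW Xx)).
    by move=> z Xz _; have z1 : -1 < z by [lra|]; derive; ring.
  move=> z Xz _; rewrite max0E ?(le_trans (ltW X0))// subr_le0 ler_expR lerN2.
  exact: gX.
have [l1 P1l J1] := primitive_bounded ce (fun x _ => expR_ge0 _) DP1 P1B.
have [J [DJ JP Jy]] : exists J : R -> R,
    [/\ forall x, -1 < x -> is_derive x 1 J (- expR (- g (Num.max 0 x))),
    forall x, J x = l1 - P1 x & J x @[x --> +oo] --> 0].
  exists (fun x => l1 - P1 x); split=> // [x x1|]; first by derive; ring.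
  by rewrite -(subrr l1); apply: cvgB => //; exact: cvg_cst.
have JE y : 0 <= y -> (\int[leb]_(x in `[y, +oo[) (expR (- g x))%:E = (J y)%:E)%E.
  move=> y0; rewrite JP -J1//; apply: eq_integral => x; rewrite inE/= in_itv/= andbT => yx.
  by rewrite max0E// (le_trans y0).
have ch : continuous (fun x => expR (g (Num.max 0 x)) * J (Num.max 0 x)).
  move=> x; apply: cvgM; first exact: cexp.
  exact: (derive_continuous_max0 DJ).
have J0 x : 0 <= x -> 0 <= J x.
  by move=> x0; rewrite -lee_fin -JE// integral_ge0// => y _; rewrite lee_fin expR_ge0.
have [P2 [DP2 P20 P2E]] := primitive ch.
have h0 x : 0 <= x -> 0 <= expR (g (Num.max 0 x)) * J (Num.max 0 x).
  by move=> x0; rewrite mulr_ge0 ?expR_ge0// J0// le_max lexx.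
(* (H1) enters here: its inner integral is [J], so it bounds the primitive [P2] of [e^g J]. *)
have [l2 P2l _] : exists2 l : R, P2 x @[x --> +oo] --> l & forall y, 0 <= y ->
  (\int[leb]_(x in `[y, +oo[) (expR (g (Num.max 0 x)) * J (Num.max 0 x))%:E =
    (l - P2 y)%:E)%E.
  have HqE : (\int[leb]_(x in `[0%R, +oo[)
      (expR (g (Num.max 0 x)) * J (Num.max 0 x))%:E < +oo)%E.
    move: Hq; rewrite /H1; congr (_ < _)%E; apply: eq_integral => y.
    rewrite inE/= in_itv/= andbT => y0; rewrite max0E// gE// EFinM -JE//.
    congr (_ * _)%E; apply: eq_integral => x; rewrite inE/= in_itv/= andbT => yx.
    by rewrite gE// (le_trans y0).
  pose B2 := fine (\int[leb]_(x in `[0%R, +oo[)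
      (expR (g (Num.max 0 x)) * J (Num.max 0 x))%:E)%E.
  apply: (@primitive_bounded _ _ _ B2) => // x x0.
  rewrite -lee_fin -P2E// /B2 fineK; last first.
    rewrite ge0_fin_numE// integral_ge0// => y; rewrite /= in_itv/= andbT => y0.
    by rewrite lee_fin h0.
  apply: ge0_subset_integral => //.
  - by apply/measurable_EFinP; apply: measurable_funTS; exact: continuous_measurable_fun.
  - by move=> y; rewrite /= in_itv/= andbT => y0; rewrite lee_fin h0.
  - by move=> y /=; rewrite !in_itv/= => /andP[->].
have [H [DH Hy]] : exists H : R -> R, (forall x, -1 < x ->
    is_derive x 1 H (- (expR (g (Num.max 0 x)) * J (Num.max 0 x)))) /\
    H x @[x --> +oo] --> 0.
  exists (fun x => l2 - P2 x); split=> [x x1|]; first by derive; ring.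
  by rewrite -(subrr l2); apply: cvgB => //; exact: cvg_cst.
have [La [DLa La0 _]] := primitive (cexp _ cg).
exists g, J, H, La; split => //; last 2 first.
- by move=> x x0; apply: (is_derive_continuous (Dg x _)); lra.
- exact: JE.
split => //.
- by move=> x x0; rewrite -[x in g x]max0E ?ltW//; apply: DJ; lra.
- move=> x x0; rewrite -[x in g x]max0E ?ltW// -[x in J x]max0E ?ltW//.
  by apply: DH; lra.
- by move=> x x0; rewrite -[x in g x]max0E ?ltW//; apply: DLa; lra.
- by apply: (cvg_at_right_derive (DJ 0 _)); lra.
- by apply: (cvg_at_right_derive (DH 0 _)); lra.
- by rewrite -[X in _ --> X]La0; apply: (cvg_at_right_derive (DLa 0 _)); lra.
Qed.

End scale_exists.

(** * Summability of the spectral series *)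

Section spectral.
Set Implicit Arguments.
Unset Strict Implicit.
Context {R : realType}.
Local Notation leb := (@lebesgue_measure R).
Implicit Types (f q : R -> R) (x y : R).

Lemma within_continuous_measurable f : {within `[0, +oo[%classic, continuous f} ->
  measurable_fun (`[0, +oo[%classic : set R) f.
Proof. by move=> cf; apply: subspace_continuous_measurable_fun => //. Qed.

Lemma dens_gt0 q x : 0 < dens q x.
Proof. by rewrite mulr_gt0// expR_gt0. Qed.

Section scale_dens.
Variables (q g J H La : R -> R).
Hypothesis gE : forall x, 0 <= x -> gam q x = g x.
Hypothesis cg : forall x, 0 <= x -> {for x, continuous g}.

Lemma dens_continuous : {within `[0, +oo[%classic, continuous (dens q)}.
Proof.
apply: (@subspace_eq_continuous _ _ _ (fun x => 2 * expR (- g x))).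
  move=> x; rewrite inE/= in_itv/= andbT => x0.
  by rewrite /from_subspace /dens gE.
apply: continuous_itvcy => x x0; apply: cvgM; first exact: cvg_cst.
by apply: continuous_comp; [apply: cvgN; exact: cg|exact: continuous_expR].
Qed.

Lemma dens_integrable :
  (\int[leb]_(x in `[0%R, +oo[) (expR (- g x))%:E < +oo)%E ->
  leb.-integrable `[0, +oo[ (EFin \o dens q).
Proof.
move=> gy; have mE : measurable_fun (`[0, +oo[%classic : set R) (fun x => expR (- g x)).
  apply: within_continuous_measurable; apply: continuous_itvcy => x x0.
  by apply: continuous_comp; [apply: cvgN; exact: cg|exact: continuous_expR].
apply/integrableP; split.
  by apply/measurable_EFinP; apply: within_continuous_measurable; exact: dens_continuous.
have -> : (\int[leb]_(x in `[0%R, +oo[) `|(EFin \o dens q) x| =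
    \int[leb]_(x in `[0%R, +oo[) (2%:E * (expR (- g x))%:E))%E.
  apply: eq_integral => x; rewrite inE/= in_itv/= andbT => x0.
  by rewrite ger0_norm ?ltW ?dens_gt0// /dens gE// EFinM.
rewrite ge0_integralZl_EFin//; first exact: lte_mul_pinfty.
exact/measurable_EFinP.
Qed.

End scale_dens.

Lemma bounded_dens_integrable q f M : leb.-integrable `[0, +oo[ (EFin \o dens q) ->
  measurable_fun (`[0, +oo[%classic : set R) f -> (forall x, 0 <= x -> `|f x| <= M) ->
  leb.-integrable `[0, +oo[ (fun x => (f x * dens q x)%:E).
Proof.
move=> di mf fM.
have /measurable_EFinP md := measurable_int _ di.
have Mi : leb.-integrable `[0, +oo[ (fun x => M%:E * (EFin \o dens q) x)%E.
  exact: integrableZl.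
apply: le_integrable Mi => //.
- by apply/measurable_EFinP; exact: measurable_funM.
- move=> x; rewrite /= in_itv/= andbT => x0.
  rewrite lee_fin !normrM ler_wpM2r// (le_trans (fM _ x0))//; exact: ler_norm.
Qed.

Lemma cvg_series_bounded (u : nat -> R) B : (forall k, 0 <= u k) ->
  (forall n, \sum_(k < n) u k <= B) -> cvgn (series u).
Proof.
move=> u0 uB; apply: nondecreasing_is_cvgn.
  by apply/nondecreasing_seqP => n; rewrite /series/= big_nat_recr//= lerDl.
by exists B => _ [n _ <-]; rewrite /series/= big_mkord.
Qed.

(** With [u = c x], squaring [e^(u/2) >= u / 2] gives [e^u >= u^2 / 4]. This reduces the summability
    of [lam_k e^(- c lam_k)] to that of [1 / lam_k]. *)
Lemma mul_expRN_le c x : 0 < c -> 0 < x -> x * expR (- (c * x)) <= 4 / c ^+ 2 * x^-1.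
Proof.
move=> c0 x0; have cx : 0 < c * x by rewrite mulr_gt0.
have e2 : (c * x) ^+ 2 / 4 <= expR (c * x).
  have -> : expR (c * x) = expR (c * x / 2) ^+ 2.
    by rewrite expr2 -expRD; congr expR; field.
  have -> : (c * x) ^+ 2 / 4 = (c * x / 2) ^+ 2 by field.
  rewrite lerXn2r ?nnegrE ?expR_ge0 ?divr_ge0 ?ltW//.
  by have := @expR_ge1Dx R (c * x / 2); lra.
rewrite expRN -ler_pdivlMr ?invr_gt0 ?expR_gt0// invrK.
apply: le_trans (ler_wpM2l _ e2); last first.
  by rewrite mulr_ge0 ?divr_ge0 ?sqr_ge0 ?invr_ge0// ltW.
by rewrite le_eqVlt; apply/orP; left; apply/eqP; field; rewrite !gt_eqF.
Qed.

Lemma spectral_summable q dq (lam : nat -> R) (psi : nat -> R -> R) (t : R) :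
  C1_on_halfline q dq -> H1 q -> H2 q dq -> H3 q ->
  0 < lam 0%N -> (forall k, lam k < lam k.+1) ->
  (forall k, psi k 0 = 0 /\ {within `[0%R, +oo[%classic, continuous (psi k)} /\
     forall x, 0 < x -> derivable (psi k) x 1 /\ derivable (derive1 (psi k)) x 1 /\
       2^-1 * derive1 (derive1 (psi k)) x - q x * derive1 (psi k) x = - lam k * psi k x) ->
  (forall i j, muint q (fun x => psi i x * psi j x) = (i == j)%:R%:E) ->
  (forall k, exists M, forall x, 0 <= x -> `|psi k x| <= M) -> 0 < t ->
  [/\ leb.-integrable `[0, +oo[ (EFin \o dens q),
      {within `[0, +oo[%classic, continuous (dens q)} &
      exists m : nat -> R, [/\ forall k, 0 <= m k,
        forall k x, 0 <= x -> `|psi k x| <= m k &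
        cvgn (series (fun k => expR (- lam k * t) * m k * m k))]].
Proof.
move=> C1q Hq1 Hq2 [a [x0 [a0 [_ qa]]]] lam0 lamS psiP ortho psiM t0.
have [g [J [H [La [D gE cg Jint]]]]] := scale_exists C1q Hq1 Hq2.
have di : leb.-integrable `[0, +oo[ (EFin \o dens q).
  by apply: (dens_integrable gE cg); rewrite Jint ltry.
have dc := dens_continuous gE cg.
split=> //.
have lam_gt0 k : 0 < lam k by elim: k => // k ih; exact: lt_trans (lamS k).
have [M HM] := choice psiM.
have psiE k : eigen q (M k) (lam k) (psi k) (derive1 (psi k)).
  have [_ [_ psiD]] := psiP k; split=> x xp.
  - by have [? _] := psiD x xp; rewrite derive1E; exact: DeriveDef.
  - have [_ [d2 psiQ]] := psiD x xp.
    have -> : 2 * q x * derive1 (psi k) x - 2 * lam k * psi k x =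
      derive1 (derive1 (psi k)) x by lra.
    by rewrite derive1E; exact: DeriveDef.
  - exact/HM/ltW.
have psi0 k : psi k x @[x --> 0^'+] --> 0.
  by have [p0 [/continuous_within_itvcyP[_]]] := psiP k; rewrite p0.
have ortho' i j : exists K : R -> R,
  [/\ forall x, 0 < x -> is_derive x 1 K (2 * expR (- g x) * (psi i x * psi j x)),
      K x @[x --> 0^'+] --> 0 & K x @[x --> +oo] --> ((i == j)%:R : R)].
  pose f x := psi i x * psi j x * dens q x.
  have cf : {within `[0, +oo[%classic, continuous f}.
    have [_ [ci _]] := psiP i; have [_ [cj _]] := psiP j.
    by move=> x; apply: cvgM; [apply: cvgM; [exact: ci|exact: cj]|exact: dc].
  have [K [DK K0 KE]] := primitive (continuous_comp_max0 cf).
  exists K; split.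
  - move=> x xp; apply: (is_derive1_eq (DK x _)); first by lra.
    by rewrite max_r ?ltW// /f /dens gE ?ltW//; ring.
  - by rewrite -[X in _ --> X]K0; apply: (cvg_at_right_derive (DK 0 _)); lra.
  - have fE : (\int[leb]_(x in `[0%R, +oo[) (f (Num.max 0 x))%:E)%E = (i == j)%:R%:E.
      rewrite -ortho /muint; apply: eq_integral => x.
      by rewrite inE/= in_itv/= andbT => xp; rewrite max_r.
    have -> : (i == j)%:R = fine (\int[leb]_(x in `[0%R, +oo[) (f (Num.max 0 x))%:E)%E.
      by rewrite fE.
    apply: primitive_cvgy KE; first exact: continuous_comp_max0.
    have fi : leb.-integrable `[0, +oo[ (fun x => (psi i x * psi j x * dens q x)%:E).
      apply: (@bounded_dens_integrable _ _ (M i * M j)) => //.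
        by apply: measurable_funM; apply: within_continuous_measurable;
          [have [_ []] := psiP i|have [_ []] := psiP j].
      by move=> x xp; rewrite normrM ler_pM// HM.
    apply: eq_integrable fi; first by [].
    move=> x; rewrite inE/= in_itv/= andbT => xp.
    by rewrite /= max_r.
(* As [9 * (t / 18) = t / 2], half of the decay [e^(- lam_k t)] survives multiplication by
   [m k ^+ 2]. *)
have d0 : 0 < t / 18 by rewrite divr_gt0.
have [C C0 HC] := eigen_sup_bound D a0 qa d0.
pose m k := Num.sqrt (C * lam k * expR (9 * (t / 18) * lam k)).
have mm k : m k ^+ 2 = C * lam k * expR (9 * (t / 18) * lam k).
  by rewrite sqr_sqrtr// !mulr_ge0 ?expR_ge0// ltW.
exists m; split.
- by move=> k; exact: sqrtr_ge0.
- move=> k x; rewrite le_eqVlt => /predU1P[<-|xp].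
    by have [-> _] := psiP k; rewrite normr0 sqrtr_ge0.
  rewrite -sqrtr_sqr ler_wsqrtr//; apply: HC (psiE k) _ x xp => // y yp.
  exact: (psi_sqr_le D lam_gt0 psiE psi0 ortho').
- have inv_cvg : cvgn (series (fun k => C * (4 / (t / 2) ^+ 2) * (lam k)^-1)).
    apply: (@cvg_series_bounded _ (C * (4 / (t / 2) ^+ 2) * (2 * H 0))) => [k|n].
      by rewrite !mulr_ge0 ?invr_ge0 ?sqr_ge0// ltW.
    rewrite -mulr_sumr ler_wpM2l//; last exact: (sum_inv_lam_le D lam_gt0 psiE psi0 ortho').
    by rewrite !mulr_ge0 ?invr_ge0 ?sqr_ge0// ltW.
  apply: (series_le_cvg _ _ _ inv_cvg) => k.
  + by rewrite !mulr_ge0 ?expR_ge0 ?sqrtr_ge0.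
  + by rewrite !mulr_ge0 ?invr_ge0 ?sqr_ge0// ltW.
  + rewrite -mulrA -expr2 mm.
    have -> : expR (- lam k * t) * (C * lam k * expR (9 * (t / 18) * lam k)) =
        C * (lam k * expR (- (t / 2 * lam k))).
      rewrite mulrCA -!mulrA; congr (_ * (_ * _)).
      by rewrite -expRD; congr expR; field.
    rewrite -[leRHS]mulrA ler_wpM2l ?(ltW C0)//; apply: mul_expRN_le => //.
    by rewrite divr_gt0.
Qed.

End spectral.

(** * Dominated convergence for series *)

Section series.
Set Implicit Arguments.
Unset Strict Implicit.
Context {R : realType}.
Implicit Types (u l b : nat -> R).

Lemma norm_le_series_cvg u b : (forall k, `|u k| <= b k) -> cvgn (series b) ->
  cvgn (series u).
Proof.
move=> ub cb; apply: normed_cvg; apply: series_le_cvg cb => // k.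
  exact: normr_ge0.
exact: le_trans (normr_ge0 _) (ub k).
Qed.

Lemma lim_series_tail_le u b n : (forall k, `|u k| <= b k) -> cvgn (series b) ->
  `|limn (series u) - series u n| <= limn (series b) - series b n.
Proof.
move=> ub cb; have cu := norm_le_series_cvg ub cb.
have cun : `|series u k - series u n| @[k --> \oo] --> `|limn (series u) - series u n|.
  by apply: cvg_norm; apply: cvgB => //; exact: cvg_cst.
have cbn : series b k - series b n @[k --> \oo] --> limn (series b) - series b n.
  by apply: cvgB => //; exact: cvg_cst.
apply: (ler_cvg_to cun cbn); near=> k.
have nk : (n <= k)%N by near: k; exact: nbhs_infty_ge.
rewrite !sub_series_geq// (le_trans (ler_norm_sum _ _ _))//.
by apply: ler_sum => i _; exact: ub.
Unshelve. all: by end_near. Qed.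

Lemma norm_lim_series_le u b : (forall k, `|u k| <= b k) -> cvgn (series b) ->
  `|limn (series u)| <= limn (series b).
Proof.
move=> ub cb; have := lim_series_tail_le 0 ub cb.
by rewrite /series/= !big_geq// !subr0.
Qed.

(** Cut at an index where the tail of [b] is at most [e / 4]: the head and the two tails cost at
    most [3 e / 4]. The filter is arbitrary because the result serves [y -> +oo], [s -> t^'+] and
    continuity in [x]. *)
Lemma tannery {T : Type} (F : set_system T) {FF : Filter F} (u : nat -> T -> R) l b :
  (forall k, u k x @[x --> F] --> l k) ->
  (\forall x \near F, forall k, `|u k x| <= b k) -> (forall k, `|l k| <= b k) ->
  cvgn (series b) ->
  limn (series (u ^~ x)) @[x --> F] --> limn (series l).
Proof.
move=> ul ub lb cb; apply/cvgrPdist_le => e e0.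
have e4 : 0 < e / 4 by rewrite divr_gt0.
have [n bn] : exists n, limn (series b) - series b n <= e / 4.
  have /cvgrPdist_le/(_ _ e4)[n _ /(_ n (leqnn n))] := cb.
  by exists n; apply: le_trans (ler_norm _) _.
have sul : series (u ^~ x) n @[x --> F] --> series l n.
  rewrite (_ : (fun x : T => series (u ^~ x) n) = fun x : T => \sum_(k < n) u k x).
    by rewrite /series/= big_mkord; apply: cvg_sum_ord => k; exact: ul.
  by apply/funext => x; rewrite /series/= big_mkord.
near=> x.
have ubx k : `|u k x| <= b k by move: k; near: x.
have sx : `|series l n - series (u ^~ x) n| <= e / 4.
  by near: x; move/cvgrPdist_le : sul; exact.
have := lim_series_tail_le n lb cb; have := lim_series_tail_le n ubx cb.
move: sx bn; rewrite !ler_norml; lra.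
Unshelve. all: by end_near. Qed.

Variables (psi : nat -> R -> R) (m al : nat -> R).
Hypothesis psi_le : forall k x, 0 <= x -> `|psi k x| <= m k.
Hypothesis al_ge0 : forall k, 0 <= al k.
Hypothesis alm_cvg : cvgn (series (fun k => al k * m k)).

(** Both [r(s,y,.)] and [r(s,oo,.)] have this form, the exponential being merged into [a k]; [al] is
    a common majorant of the coefficients. *)
Definition psi_series (a : nat -> R) (x : R) := limn (series (fun k => a k * psi k x)).

Lemma psi_term_le a (x : R) : (forall k, `|a k| <= al k) -> 0 <= x ->
  forall k, `|a k * psi k x| <= al k * m k.
Proof. by move=> aal x0 k; rewrite normrM ler_pM// psi_le. Qed.

Lemma psi_series_cvg a (x : R) : (forall k, `|a k| <= al k) -> 0 <= x ->
  cvgn (series (fun k => a k * psi k x)).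
Proof. by move=> aal x0; exact: norm_le_series_cvg (psi_term_le aal x0) alm_cvg. Qed.

Lemma psi_series_bound a (x : R) : (forall k, `|a k| <= al k) -> 0 <= x ->
  `|psi_series a x| <= limn (series (fun k => al k * m k)).
Proof. by move=> aal x0; exact: norm_lim_series_le (psi_term_le aal x0) alm_cvg. Qed.

Lemma psi_series_continuous a : (forall k, `|a k| <= al k) ->
  (forall k, {within `[0, +oo[%classic, continuous (psi k)}) ->
  {within `[0, +oo[%classic, continuous (psi_series a)}.
Proof.
move=> aal cpsi; apply/subspace_continuousP => x; rewrite /= in_itv/= andbT => x0.
apply: (@tannery _ _ _ (fun k x => a k * psi k x) _ (fun k => al k * m k)) => //.
- move=> k; apply: cvgMr; have /subspace_continuousP := cpsi k; apply.
  by rewrite /= in_itv/= andbT.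
- apply: filterS (withinT _ _) => y; rewrite /= in_itv/= andbT.
  exact: psi_term_le.
- exact: psi_term_le.
Qed.

(** The error is the sum of [|a y k - l k| m_k], in which [x] no longer occurs; [tannery] sends it
    to 0 with majorant [2 al m]. *)
Lemma psi_series_cvg_uniform {T : Type} (F : set_system T) {FF : Filter F}
    (a : T -> nat -> R) (l : nat -> R) :
  (forall k, a y k @[y --> F] --> l k) ->
  (\forall y \near F, forall k, `|a y k| <= al k) -> (forall k, `|l k| <= al k) ->
  exists2 e : T -> R, e y @[y --> F] --> 0 &
  \forall y \near F, forall x, 0 <= x -> `|psi_series (a y) x - psi_series l x| <= e y.
Proof.
move=> al_ aal lal.
have m0 k : 0 <= m k by apply: le_trans (psi_le k (lexx 0)).
have c2 : cvgn (series (fun k => 2 * (al k * m k))).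
  exact: (is_cvg_seriesZ (k := 2) alm_cvg).
have ale (y : T) k : (forall k, `|a y k| <= al k) -> `|a y k - l k| * m k <= 2 * (al k * m k).
  move=> ay; rewrite mulrA ler_wpM2r// (le_trans (ler_normB _ _))//.
  by have := ay k; have := lal k; lra.
exists (fun y => limn (series (fun k => `|a y k - l k| * m k))).
  have <- : limn (series (fun=> 0 : R)) = 0.
    rewrite (_ : series _ = fun=> 0) ?lim_cst//.
    by apply/funext => n; rewrite /series/= big1.
  apply: (@tannery _ _ _ (fun k y => `|a y k - l k| * m k) _ (fun k => 2 * (al k * m k))) => //.
  - move=> k; rewrite -[X in _ --> X](mul0r (m k)); apply: cvgMl.
    rewrite -[X in _ --> X](@normr0 R R) -(subrr (l k)).
    by apply: cvg_norm; apply: cvgB => //; exact: cvg_cst.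
  - by apply: filterS aal => y ay k; rewrite normrM normr_id (ger0_norm (m0 k)) ale.
  - by move=> k; rewrite normr0 !mulr_ge0.
apply: filterS aal => y ay x x0.
have cd : cvgn (series (fun k => `|a y k - l k| * m k)).
  apply: norm_le_series_cvg c2 => k.
  by rewrite normrM normr_id (ger0_norm (m0 k)) ale.
rewrite /psi_series.
have -> : limn (series (fun k => a y k * psi k x)) - limn (series (fun k => l k * psi k x)) =
    limn (series (fun k => (a y k - l k) * psi k x)).
  rewrite -lim_seriesB; [|exact: psi_series_cvg..].
  by congr (limn (series _)); apply/funext => k; rewrite /= -mulrBl.
by apply: norm_lim_series_le cd => k; rewrite normrM ler_wpM2l// psi_le.
Qed.

End series.

(** * Densities *)

Section density.
Set Implicit Arguments.
Unset Strict Implicit.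
Context {R : realType}.
Local Notation leb := (@lebesgue_measure R).
Local Open Scope ereal_scope.
Import HBNNSimple.

Section approx.
Context d (T : measurableType d) (mu : {measure set T -> \bar R}).
Variables (D : set T) (mD : measurable D) (phi w : T -> R).
Hypotheses (mphi : measurable_fun D phi) (mw : measurable_fun D w).
Hypothesis w0 : forall x, D x -> (0 <= w x)%R.
Variables (f : R -> R) (mf : measurable_fun setT (EFin \o f)).
Hypothesis f0 : forall x, (0 <= f x)%R.

(** The right-hand side sees [phi] and [w] only through integrals of [1_A(phi) w]. Two weighted laws
    that agree on Borel sets therefore integrate every nonnegative measurable [f] alike. *)
Lemma ge0_integral_comp_approx (h := nnsfun_approx measurableT mf) :
  \int[mu]_(x in D) (f (phi x) * w x)%:E = limn (fun n =>
    \sum_(k \in range (h n))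
      (k%:E * \int[mu]_(x in D) (\1_(h n @^-1` [set k]) (phi x) * w x)%:E)).
Proof.
have mh n : measurable_fun D (fun x => h n (phi x)).
  by apply: measurableT_comp => //; exact: measurable_funP.
have -> : \int[mu]_(x in D) (f (phi x) * w x)%:E =
    \int[mu]_(x in D) limn (fun n => (h n (phi x) * w x)%:E).
  apply: eq_integral => x /[!inE] Dx; apply/esym/cvg_lim => //.
  rewrite (_ : (fun n => _) = fun n => (h n (phi x))%:E * (w x)%:E) ?EFinM//.
  apply: (cvgeZr (f := fun n => (h n (phi x))%:E) (y := (w x)%:E)) => //.
  exact: (@cvg_nnsfun_approx _ _ _ _ measurableT _ mf (fun x _ => f0 x) (phi x) I).
rewrite monotone_convergence//; last 3 first.
- by move=> n; apply/measurable_EFinP; exact: measurable_funM.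
- by move=> n x Dx; rewrite lee_fin mulr_ge0// w0.
- move=> x Dx a b ab; rewrite lee_fin ler_wpM2r ?w0//.
  exact/lefP/nd_nnsfun_approx.
congr (limn _); apply/funext => n.
have mind k : measurable_fun D (fun x => (\1_(h n @^-1` [set k]) (phi x) * w x)%R).
  apply: measurable_funM => //; apply: measurableT_comp => //.
under eq_integral => x _.
  rewrite fimfunE mulr_fsuml// -fsumEFin//; over.
rewrite /= ge0_integral_fsum//; last 2 first.
- move=> k; apply/measurable_EFinP; apply: measurable_funM => //.
  by apply: measurable_funM => //; exact: measurableT_comp.
- move=> k x Dx; rewrite lee_fin mulr_ge0 ?w0//.
  by have := nnfun_muleindic_ge0 (h n) k (phi x); rewrite lee_fin.
apply: eq_fsbigr => k; rewrite inE => -[z _ <-].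
under eq_integral => x _ do rewrite -mulrA EFinM.
rewrite ge0_integralZl_EFin//.
- by move=> x Dx; rewrite lee_fin mulr_ge0 ?w0.
- exact/measurable_EFinP.
Qed.

End approx.

Lemma ge0_integral_comp_eq d1 (T1 : measurableType d1) (mu1 : {measure set T1 -> \bar R})
    d2 (T2 : measurableType d2) (mu2 : {measure set T2 -> \bar R})
    (D1 : set T1) (D2 : set T2) (phi1 w1 : T1 -> R) (phi2 w2 : T2 -> R) (f : R -> R) :
  measurable D1 -> measurable_fun D1 phi1 -> measurable_fun D1 w1 ->
  (forall x, D1 x -> (0 <= w1 x)%R) ->
  measurable D2 -> measurable_fun D2 phi2 -> measurable_fun D2 w2 ->
  (forall x, D2 x -> (0 <= w2 x)%R) ->
  (forall A : set R, measurable A ->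
    \int[mu1]_(x in D1) (\1_A (phi1 x) * w1 x)%:E =
    \int[mu2]_(x in D2) (\1_A (phi2 x) * w2 x)%:E) ->
  measurable_fun setT f -> (forall x, (0 <= f x)%R) ->
  \int[mu1]_(x in D1) (f (phi1 x) * w1 x)%:E =
  \int[mu2]_(x in D2) (f (phi2 x) * w2 x)%:E.
Proof.
move=> mD1 mp1 mw1 w10 mD2 mp2 mw2 w20 HA mf f0.
have mf' : measurable_fun setT (EFin \o f) by exact/measurable_EFinP.
rewrite (ge0_integral_comp_approx mu1 mD1 mp1 mw1 w10 mf' f0).
rewrite (ge0_integral_comp_approx mu2 mD2 mp2 mw2 w20 mf' f0).
congr (limn _); apply/funext => n; apply: eq_fsbigr => k _.
by rewrite HA.
Qed.

(* No measurability of [f] is assumed: a simple function below [f] stays below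
   [g] once it is set to 0 on [N]. *)
Lemma ge0_le_integral_off_null d (T : measurableType d) (mu : {measure set T -> \bar R})
    (N : set T) (f g : T -> \bar R) : measurable N -> mu N = 0 ->
  (forall x, 0 <= f x) -> (forall x, 0 <= g x) -> (forall x, ~ N x -> f x = g x) ->
  \int[mu]_x f x <= \int[mu]_x g x.
Proof.
move=> mN N0 f0 g0 fg; rewrite ge0_integralTE// [leRHS]ge0_integralTE//.
apply: ge_ereal_sup => _ [h hf <-]; apply: ereal_sup_ubound.
have mCN : measurable (~` N) by exact: measurableC.
exists (proj_nnsfun h mCN) => [x|].
  rewrite -mrestrict patchE; case: ifPn => [|_]; last exact: g0.
  by rewrite inE/= => /fg <-.
rewrite -!integralT_nnsfun; apply: ge0_ae_eq_integral => //.
- by apply/measurable_EFinP.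
- by apply/measurable_EFinP.
- by move=> x _; rewrite lee_fin.
- by move=> x _; rewrite lee_fin.
exists N; split => // x /= /not_implyP[_ hx].
apply: contrapT => Nx; apply: hx.
have e : proj_nnsfun h mCN x = h x by rewrite -mrestrict patchE mem_set.
by congr EFin; exact: e.
Qed.

(** Meant for [f (X w)] with [f] measurable on the half-line only: this composite need not be
    measurable where [X] is negative. *)
Lemma integral_eq_off_null d (T : measurableType d) (mu : {measure set T -> \bar R})
    (D N : set T) (f g : T -> \bar R) : measurable N -> mu N = 0 ->
  (forall x, D x -> ~ N x -> f x = g x) ->
  \int[mu]_(x in D) f x = \int[mu]_(x in D) g x.
Proof.
move=> mN N0 fg.
have ge0_eq (u v : T -> \bar R) : (forall x, 0 <= u x) -> (forall x, 0 <= v x) ->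
    (forall x, ~ N x -> u x = v x) -> \int[mu]_x u x = \int[mu]_x v x.
  move=> u0 v0 uv; apply/eqP; rewrite eq_le; apply/andP; split;
    apply: (ge0_le_integral_off_null mN N0) => // x Nx; by rewrite uv.
rewrite integral_mkcond [RHS]integral_mkcond integralE [RHS]integralE.
have fgD x : ~ N x -> (f \_ D) x = (g \_ D) x.
  by move=> Nx; rewrite !patchE; case: ifPn => //; rewrite inE => Dx; exact: fg.
by congr (_ - _); apply: ge0_eq => // x Nx; rewrite ?funeposE ?funenegE fgD.
Qed.

Variable q : R -> R.
Hypothesis dens_cont : {within `[0%R, +oo[%classic, continuous (dens q)}.

(** As [r >= 0], the positive part of [r f] is [r] times that of [f], and likewise for negative
    parts; the two halves of the integral agree separately, so the equality holds in the extended
    reals. *)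
Lemma density_integral d (T : measurableType d) (P : {measure set T -> \bar R})
    (E : set T) (X : T -> R) (r : R -> R) :
  measurable E -> measurable_fun setT X ->
  measurable_fun (`[0%R, +oo[%classic : set R) r -> (forall x, (0 <= x)%R -> (0 <= r x)%R) ->
  (forall A : set R, measurable A -> P (X @^-1` A `&` E) =
    \int[leb]_(x in A `&` `[0%R, +oo[%classic) (r x * dens q x)%:E) ->
  forall f : R -> R, measurable_fun (`[0%R, +oo[%classic : set R) f ->
  \int[P]_(w in E) (f (X w))%:E = muint q (fun x => (r x * f x)%R).
Proof.
move=> mE mX mr r0 HA f mf.
have mpos : measurable (`[0%R, +oo[%classic : set R) by [].
have md := within_continuous_measurable dens_cont.
have d0 x : (0 <= dens q x)%R by exact/ltW/dens_gt0.
have mneg : measurable (~` `[0%R, +oo[%classic : set R) by exact: measurableC.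
have mXA A : measurable A -> measurable (X @^-1` A).
  by move=> mA; rewrite -[X in measurable X]setTI; exact: mX.
(* On [E] the value of [X] is almost surely nonnegative, because the law charges nothing off the
   half-line; [f], uncontrolled there, can be replaced by [h]. *)
pose N := X @^-1` (~` `[0%R, +oo[%classic) `&` E.
have mN : measurable N by apply: measurableI => //; exact: mXA.
have N0 : P N = 0 by rewrite /N HA// setICl integral_set0.
pose h := f \_ `[0%R, +oo[%classic.
have mh : measurable_fun setT h.
  by apply/(measurable_restrictT _ mpos).
have hE x : (0 <= x)%R -> h x = f x.
  by move=> x0; rewrite /h patchE mem_set//= in_itv/= x0.
have eq_ge0 (u : R -> R) : measurable_fun setT u -> (forall x, (0 <= u x)%R) ->
    \int[P]_(w in E) (u (X w))%:E =
    \int[leb]_(x in `[0%R, +oo[) (u x * (r x * dens q x))%:E.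
  move=> mu u0.
  transitivity (\int[P]_(w in E) (u (X w) * 1)%:E).
    by apply: eq_integral => w _; rewrite mulr1.
  apply: (@ge0_integral_comp_eq _ _ P _ _ leb E `[0%R, +oo[%classic X (fun=> 1%R) id
    (fun x => (r x * dens q x)%R) u) => //.
  - exact: measurable_funTS.
  - exact: measurable_funM.
  - by move=> x; rewrite /= in_itv/= andbT => x0; rewrite mulr_ge0// r0.
  move=> A mA.
  under eq_integral do rewrite mulr1.
  rewrite (eq_integral (fun w => (\1_(X @^-1` A) w)%:E)); last by [].
  rewrite integral_indic//; last exact: mXA.
  rewrite HA// setIC integral_mkcondr; apply: eq_integral => x _.
  by rewrite patchE indicE; case: (x \in A); rewrite ?mul1r ?mul0r.
transitivity (\int[P]_(w in E) (h (X w))%:E).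
  apply: (integral_eq_off_null mN N0) => w Ew Nw; rewrite hE//.
  rewrite leNgt; apply/negP => Xw; apply: Nw; split => //=.
  by rewrite in_itv/= andbT leNgt Xw.
rewrite /muint integralE [RHS]integralE; congr (_ - _).
- transitivity (\int[P]_(w in E) (h^\+ (X w))%:E).
    by apply: eq_integral => w _; rewrite funeposE /funrpos EFin_max.
  rewrite eq_ge0//; last exact: measurable_funrpos.
  apply: eq_integral => x; rewrite inE/= in_itv/= andbT => x0.
  rewrite funeposE /funrpos hE// -EFin_max; congr EFin.
  rewrite mulrAC (mulrC (Num.max _ _)) maxr_pMr ?mulr_ge0 ?r0// mulr0.
  by congr (Num.max _ _); ring.
- transitivity (\int[P]_(w in E) (h^\- (X w))%:E).
    by apply: eq_integral => w _; rewrite funenegE /funrneg EFin_max.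
  rewrite eq_ge0//; last exact: measurable_funrneg.
  apply: eq_integral => x; rewrite inE/= in_itv/= andbT => x0.
  rewrite funenegE /funrneg hE// -EFinN -EFin_max; congr EFin.
  rewrite (mulrC (Num.max _ _)) maxr_pMr ?mulr_ge0 ?r0// mulr0.
  by congr (Num.max _ _); ring.
Qed.

(** A negative value would by continuity give a short interval of negative mass. *)
Lemma density_ge0 (r : R -> R) : {within `[0%R, +oo[%classic, continuous r} ->
  (forall A : set R, measurable A ->
    0 <= \int[leb]_(x in A `&` `[0%R, +oo[%classic) (r x * dens q x)%:E) ->
  forall x, (0 <= x)%R -> (0 <= r x)%R.
Proof.
move=> cr HA x0 x00; rewrite leNgt; apply/negP => rx0.
pose v x := (r x * dens q x)%R.
have vx0 : (v x0 < 0)%R by rewrite nmulr_rlt0// dens_gt0.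
have cv : {within `[0%R, +oo[%classic, continuous v}.
  by move=> x; apply: cvgM; [exact: cr|exact: dens_cont].
have c0 : (v x0 / 2 < 0)%R by lra.
(* The interval extends to the right of [x0], so that [x0 = 0] is covered. *)
have [e e0 ev] : exists2 e : R, (0 < e)%R &
    forall x, (x0 <= x)%R -> (x <= x0 + e)%R -> (v x <= v x0 / 2)%R.
  move/subspace_continuousP : cv => /(_ x0).
  rewrite /= in_itv/= x00 => /(_ isT) /cvgrPdist_lt /(_ (- (v x0 / 2))%R).
  have -> : (0 < - (v x0 / 2))%R by lra.
  move=> /(_ isT); rewrite /within/= => -[e /= e0 He].
  exists (e / 2)%R => [|x x0x xe]; first by rewrite divr_gt0.
  have xx : (`|x0 - x| < e)%R by rewrite distrC ger0_norm; lra.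
  have xp : (0 <= x)%R by lra.
  have := He x xx; rewrite /= in_itv/= xp => /(_ isT).
  rewrite /from_subspace ltr_norml.
  by move: (v x0) (v x) => a b /andP[+ _]; clear; lra.
pose A : set R := `[x0, (x0 + e)%R]%classic.
have mA : measurable A by rewrite /A.
have AI : A `&` `[0%R, +oo[%classic = A.
  rewrite setIidl// => x; rewrite /A/= !in_itv/= => /andP[x0x _].
  by rewrite andbT (le_trans x00).
have : \int[leb]_(x in A) (v x)%:E <= \int[leb]_(x in A) (v x0 / 2)%:E.
  apply: le_integral => //.
  - apply: continuous_compact_integrable; first exact: segment_compact.
    apply: continuous_subspaceW cv => x; rewrite /A/= !in_itv/= => /andP[x0x _].
    by rewrite andbT (le_trans x00).
  - by apply: continuous_integrable; exact: cst_continuous.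
  - move=> x; rewrite inE/A/= in_itv/= => /andP[? ?].
    by rewrite lee_fin ev.
have := HA A mA; rewrite AI => /le_trans /[apply].
rewrite integral_cst// [X in _ * X](_ : _ = e%:E); last first.
  transitivity (lebesgue_measure A) => //.
  by rewrite /A lebesgue_measure_itv/= lte_fin ltrDl e0 -EFinB addrAC subrr add0r.
by rewrite -EFinM lee_fin leNgt nmulr_rlt0// e0.
Qed.

End density.

(** * Laws as measures, and their comparison on open sets *)

Section law.
Set Implicit Arguments.
Unset Strict Implicit.
Local Open Scope ereal_scope.
Context {R : realType}.

Section law_on.
Context d (T : measurableType d) (P : {measure set T -> \bar R}).
Variables (E : set T) (X : T -> R).

(* The proofs are arguments so that the measure structure can be inferred. *)
Definition law_on (mE : measurable E) (mX : measurable_fun setT X) (A : set R) :=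
  P (X @^-1` A `&` E).

Hypotheses (mE : measurable E) (mX : measurable_fun setT X).

Let law_on0 : law_on mE mX set0 = 0.
Proof. by rewrite /law_on preimage_set0 set0I measure0. Qed.

Let law_on_ge0 A : 0 <= law_on mE mX A.
Proof. exact: measure_ge0. Qed.

Let law_on_sigma_additive : semi_sigma_additive (law_on mE mX).
Proof.
move=> F mF tF mU; rewrite /law_on preimage_bigcup setI_bigcupl.
have mFi i : measurable (X @^-1` F i `&` E).
  by apply: measurableI => //; rewrite -[X in measurable X]setTI; exact: mX.
apply: measure_semi_sigma_additive => //.
- apply/trivIsetP => i j _ _ ij; rewrite setIACA setIid -preimage_setI.
  by move/trivIsetP : tF => /(_ i j Logic.I Logic.I ij) ->; rewrite preimage_set0 set0I.
- exact: bigcupT_measurable.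
Qed.

HB.instance Definition _ := isMeasure.Build _ _ _ (law_on mE mX)
  law_on0 law_on_ge0 law_on_sigma_additive.

End law_on.

Section density_measure.
Context d (T : measurableType d) (mu : {measure set T -> \bar R}).
Variable f : T -> \bar R.

Definition density_measure (mf : measurable_fun setT f) (f0 : forall x, 0 <= f x)
  (A : set T) := \int[mu]_(x in A) f x.

Hypotheses (mf : measurable_fun setT f) (f0 : forall x, 0 <= f x).

Let density0 : density_measure mf f0 set0 = 0.
Proof. by rewrite /density_measure integral_set0. Qed.

Let density_ge0 A : 0 <= density_measure mf f0 A.
Proof. exact: integral_ge0. Qed.

Let density_sigma_additive : semi_sigma_additive (density_measure mf f0).
Proof.
move=> /= F mF tF mUF; rewrite /density_measure; apply: cvg_toP.
  apply: ereal_nondecreasing_is_cvgn => m n mn.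
  by apply: lee_sum_nneg_natr => // k _ _; exact: integral_ge0.
by rewrite ge0_integral_bigcup//=; exact: measurable_funTS.
Qed.

HB.instance Definition _ := isMeasure.Build _ _ _ (density_measure mf f0)
  density0 density_ge0 density_sigma_additive.

End density_measure.

(* Continuity from above transfers the inequality from open to closed rays;
   since the total masses agree, taking complements gives the equality. *)
Lemma open_le_measure_eq (m1 m2 : {measure set R -> \bar R}) :
  m1 setT = m2 setT -> m2 setT < +oo ->
  (forall U : set R, open U -> m1 U <= m2 U) ->
  forall A : set R, measurable A -> m1 A = m2 A.
Proof.
move=> m12T m2oo m12.
have fin1 (A : set R) : measurable A -> m1 A \is a fin_num.
  move=> mA; rewrite ge0_fin_numE// (le_lt_trans _ m2oo)// -m12T.
  by apply: le_measure; rewrite ?inE.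
have fin2 (A : set R) : measurable A -> m2 A \is a fin_num.
  move=> mA; rewrite ge0_fin_numE// (le_lt_trans _ m2oo)//.
  by apply: le_measure; rewrite ?inE.
have ray x : m1 `[x, +oo[%classic = m2 `[x, +oo[%classic.
  apply/eqP; rewrite eq_le; apply/andP; split.
    pose F k : set R := `](x - k.+1%:R^-1)%R, +oo[%classic.
    have FE : `[x, +oo[%classic = \bigcap_k F k by exact: itvcyEbigcap.
    have mF k : measurable (F k) by rewrite /F.
    have Fni : nonincreasing_seq F.
      move=> i j ij; apply/subsetPset => y; rewrite /F/= !in_itv/= !andbT.
      apply: le_lt_trans; rewrite lerD2l lerN2 lef_pV2 ?posrE// ler_nat.
      by rewrite ltnS.
    have m2F : m2 \o F @ \oo --> m2 (\bigcap_k F k).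
      apply: nonincreasing_cvg_mu => //; last by rewrite -FE.
      by rewrite -ge0_fin_numE// fin2.
    rewrite FE; apply: (cvge_to_ge m2F); apply: nearW => k /=.
    rewrite (@le_trans _ _ (m1 (F k)))//; last first.
      by apply: m12; rewrite /F; exact: interval_open.
    by apply: le_measure; rewrite ?inE -?FE// FE => y; exact.
  have mC : measurable (`]-oo, x[%classic : set R) by [].
  have -> : `[x, +oo[%classic = setT `\` `]-oo, x[%classic.
    by rewrite setTD -setCitvl.
  rewrite !measureD ?setTI// ?m12T//; last first.
    by rewrite -ge0_fin_numE// fin1.
  by apply: leeB; [by rewrite le_eqVlt; apply/orP; left; apply/eqP; exact/esym/m12T|apply: m12; exact: interval_open].
have GI : setI_closed (@RGenCInfty.G R).
  move=> _ _ [x ->] [y ->]; exists (Num.max x y); apply/seteqP; split => z /=;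
    rewrite !in_itv/= !andbT ge_max; first by move=> [-> ->].
  by move=> /andP.
have cover : \bigcup_n (`[(- n%:R)%R, +oo[%classic : set R) = setT.
  apply/seteqP; split => // x _; exists (Num.truncn `|x|%R).+1 => //=.
  rewrite in_itv/= andbT lerNl (le_trans (ler_norm _))// normrN ltW//.
  by have /andP[_] := truncn_itv (normr_ge0 x).
have mE : (measurable : set (set R)) = <<s @RGenCInfty.G R >>.
  exact: RGenCInfty.measurableE.
have Gg n : (@RGenCInfty.G R) `[(- n%:R)%R, +oo[%classic by exists (- n%:R)%R.
have GE A : (@RGenCInfty.G R) A -> m1 A = m2 A by move=> [x ->]; exact: ray.
have Goo k : m1 `[(- k%:R)%R, +oo[%classic < +oo by rewrite -ge0_fin_numE// fin1.
move=> A mA.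
exact: (@measure_unique _ R _ _ _ mE GI Gg cover m1 m2 GE Goo A mA).
Qed.

(** Fatou's lemma for sets: up to a null set [A] lies in the lower limit of the [B n], the
    increasing union of the tail intersections [F n]. *)
Lemma measure_le_cvg d (T : measurableType d) (P : {measure set T -> \bar R})
    (A : set T) (B : nat -> set T) (l : \bar R) :
  measurable A -> (forall n, measurable (B n)) ->
  {ae P, forall w, A w -> \forall n \near \oo, B n w} ->
  P (B n) @[n --> \oo] --> l -> P A <= l.
Proof.
move=> mA mB [N [mN N0 AN]] Bl.
pose F n := \bigcap_(k in [set k | (n <= k)%N]) B k.
have mF n : measurable (F n) by apply: bigcap_measurable => //; exists n => /=.
have Fnd : nondecreasing_seq F.
  by move=> i j ij; apply/subsetPset => w Fw k /= jk; apply: Fw; exact: leq_trans jk.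
have mUF : measurable (\bigcup_n F n) by exact: bigcupT_measurable.
have PF : P \o F @ \oo --> P (\bigcup_n F n) by exact: nondecreasing_cvg_mu.
apply: (@le_trans _ _ (P (\bigcup_n F n))); last first.
  apply: (lee_cvg_to PF Bl); apply: nearW => n /=.
  by apply: le_measure; rewrite ?inE// => w Fw; apply: Fw => /=.
rewrite -(measureU0 mUF mN N0); apply: le_measure; rewrite ?inE//.
  exact: measurableU.
move=> w Aw; have [Nw|Nw] := pselect (N w); [by right|left].
have AB : A w -> \forall n \near \oo, B n w.
  by apply: contrapT => nB; apply: Nw; exact: AN.
by have [n _ Bn] := AB Aw; exists n => // k /= nk; exact: Bn.
Qed.

End law.

(** * The law at infinity *)

Section limits.
Set Implicit Arguments.
Unset Strict Implicit.
Context {R : realType}.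
Local Notation leb := (@lebesgue_measure R).

Section limit_law.
Local Open Scope ereal_scope.
Context d (Omega : measurableType d) (P : probability Omega R).
Variables (Xn : nat -> Omega -> R) (Tn : nat -> Omega -> \bar R).
Variables (X : Omega -> R) (T : Omega -> \bar R) (t : R).
Hypotheses (mXn : forall n, measurable_fun setT (Xn n)).
Hypotheses (mTn : forall n, measurable_fun setT (Tn n)).
Hypotheses (mX : measurable_fun setT X) (mT : measurable_fun setT T).
Hypothesis XTcvg : {ae P, forall w, (Xn n w @[n --> \oo] --> X w) /\
  (Tn n w @[n --> \oo] --> T w)}.
Variables (rho : {measure set R -> \bar R}) (M : R -> R).
Hypothesis rho_cvg : forall A, measurable A ->
  P (Xn n @^-1` A `&` [set w | t%:E < Tn n w]) @[n --> \oo] --> rho A.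
Hypothesis M_cvg : forall s, (t < s)%R ->
  P [set w | s%:E < Tn n w] @[n --> \oo] --> (M s)%:E.
Hypothesis M_right : M s @[s --> t^'+] --> fine (rho setT).

Let mgt (f : Omega -> \bar R) (s : R) : measurable_fun setT f ->
  measurable [set w | s%:E < f w].
Proof.
move=> mf; rewrite -[X in measurable X]setTI.
exact: emeasurable_fun_o_infty.
Qed.

Let mpre (Y : Omega -> R) (A : set R) : measurable_fun setT Y -> measurable A ->
  measurable (Y @^-1` A).
Proof. by move=> mY mA; rewrite -[X in measurable X]setTI; exact: mY. Qed.

(* The portmanteau inequality on open sets, together with the convergence of
   the total mass; the latter needs [M] because of a possible atom of [T] at
   [t]. *)
Lemma limit_law A : measurable A -> P (X @^-1` A `&` [set w | t%:E < T w]) = rho A.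
Proof.
have mE : measurable [set w | t%:E < T w] by exact: mgt.
have lawE B : P (X @^-1` B `&` [set w | t%:E < T w]) = law_on P mE mX B by [].
have rho1 : rho setT <= 1.
  apply: (cvge_to_le (rho_cvg measurableT)); apply: nearW => n.
  by apply: probability_le1; rewrite preimage_setT setTI; exact: mgt.
have rho_fin : rho setT \is a fin_num.
  by rewrite ge0_fin_numE// (le_lt_trans rho1)// ltry.
(* [X] in [U] and [T > t] are open conditions, hence almost surely inherited by [Xn n] and [Tn n]
   for large [n]. *)
have open_le U : open U -> law_on P mE mX U <= rho U.
  move=> oU; have mU : measurable U by exact: open_measurable.
  apply: (measure_le_cvg _ _ _ (rho_cvg mU)).
  - by apply: measurableI => //; exact: mpre.
  - by move=> n; apply: measurableI; [exact: mpre|exact: mgt].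
  apply: filterS XTcvg => w [Xw Tw] [/= UX tT]; near=> n; split => /=.
    by near: n; apply: Xw; exact: open_nbhs_nbhs.
  by near: n; exact: (Tw _ (open_ereal_gt' tT)).
rewrite lawE; apply: open_le_measure_eq => //; last first.
  by rewrite -ge0_fin_numE.
apply/eqP; rewrite eq_le (open_le _ openT)/=.
have PE : P [set w | t%:E < T w] \is a fin_num by exact: fin_num_measure.
rewrite /law_on preimage_setT setTI -(fineK rho_fin) -(fineK PE) lee_fin.
(* Where [T = t], convergence does not decide whether [Tn n > t]. A later time [s] does: [T <= t]
   forces [Tn n <= s] eventually, so the mass of [T > t] is at least [M s], and [s] then decreases
   to [t]. *)
apply: (cvgr_to_le M_right); near=> s.
have ts : (t < s)%R by near: s; exact: nbhs_right_gt.
rewrite -lee_fin (fineK PE).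
have PC B : measurable B -> P B = 1 - P (~` B).
  by move=> mB; rewrite -probability_setC ?setCK//; exact: measurableC.
have PnC n : P (~` [set w | s%:E < Tn n w]) = 1 - P [set w | s%:E < Tn n w].
  by rewrite probability_setC//; exact: mgt.
have : P (~` [set w | t%:E < T w]) <= 1 - (M s)%:E.
  apply: (@measure_le_cvg _ _ _ P _ (fun n => ~` [set w | s%:E < Tn n w])).
  - exact: measurableC.
  - by move=> n; apply: measurableC; exact: mgt.
  - apply: filterS XTcvg => w [_ Tw] /= /negP; rewrite -leNgt => Tt.
    have Ts : T w < s%:E by rewrite (le_lt_trans Tt)// lte_fin.
    near=> n; apply/negP; rewrite -leNgt ltW//.
    by near: n; exact: (Tw _ (open_ereal_lt' Ts)).
  - have : 1 - P [set w | s%:E < Tn n w] @[n --> \oo] --> 1 - (M s)%:E.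
      by apply: cvgeB => //; [exact: cvg_cst|exact: M_cvg].
    by rewrite -(funext PnC).
rewrite probability_setC// -(fineK PE) -EFinB -EFinB !lee_fin; lra.
Unshelve. all: by end_near. Qed.

End limit_law.

Variable q : R -> R.
Hypothesis dens_int : leb.-integrable `[0%R, +oo[ (EFin \o dens q).
Hypothesis dens_cont : {within `[0%R, +oo[%classic, continuous (dens q)}.

Let md : measurable_fun (`[0%R, +oo[%classic : set R) (dens q).
Proof. exact: within_continuous_measurable. Qed.

Lemma bounded_mul_integrable (r f : R -> R) (B : R) :
  measurable_fun (`[0%R, +oo[%classic : set R) r ->
  measurable_fun (`[0%R, +oo[%classic : set R) f ->
  (forall x, 0 <= x -> `|r x| <= B) ->
  leb.-integrable `[0%R, +oo[ (fun x => (f x * dens q x)%:E) ->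
  leb.-integrable `[0%R, +oo[ (fun x => (r x * f x * dens q x)%:E).
Proof.
move=> mr mf rB fi.
have Bfi : leb.-integrable `[0%R, +oo[ (fun x => B%:E * (f x * dens q x)%:E)%E.
  exact: integrableZl.
apply: le_integrable Bfi => //.
  apply/measurable_EFinP; apply: measurable_funM => //.
  exact: measurable_funM.
move=> x; rewrite /= in_itv/= andbT => x0.
rewrite lee_fin -mulrA normrM [leRHS]normrM ler_wpM2r//.
by apply: le_trans (rB _ x0) _; exact: ler_norm.
Qed.

(** The difference is at most [e y] times the [L^1(mu)] norm of [f]. *)
Lemma cvg_muint {T : Type} (F : set_system T) {FF : Filter F} (r : T -> R -> R)
    (r0 f : R -> R) (e : T -> R) (B : R) :
  measurable_fun (`[0%R, +oo[%classic : set R) r0 ->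
  (forall x, 0 <= x -> `|r0 x| <= B) ->
  (\forall y \near F, measurable_fun (`[0%R, +oo[%classic : set R) (r y) /\
     forall x, 0 <= x -> `|r y x| <= B) ->
  (\forall y \near F, forall x, 0 <= x -> `|r y x - r0 x| <= e y) ->
  e y @[y --> F] --> 0 ->
  measurable_fun (`[0%R, +oo[%classic : set R) f ->
  leb.-integrable `[0%R, +oo[ (fun x => (f x * dens q x)%:E) ->
  muint q (fun x => r y x * f x) @[y --> F] --> muint q (fun x => r0 x * f x).
Proof.
move=> mr0 r0B ryB re e0 mf fi.
have r0i := bounded_mul_integrable mr0 mf r0B fi.
rewrite -[X in _ --> X](fineK (integrable_fin_num _ r0i))//.
apply: cvg_EFin.
  apply: filterS ryB => y [mry yB].
  by apply: integrable_fin_num => //; exact: (bounded_mul_integrable mry mf yB fi).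
apply/subr_cvg0.
pose C := Rintegral leb `[0, +oo[ (fun x => `|f x * dens q x|).
apply: (@norm_le_cvg0 _ _ _ _ _ (fun y => e y * C)); last first.
  by rewrite -[X in _ --> X](mul0r C); exact: cvgMl.
apply: filterS2 ryB re => y [mry yB] rey.
have ryi := bounded_mul_integrable mry mf yB fi.
have ai : leb.-integrable `[0, +oo[ (EFin \o (fun x => `|f x * dens q x|)).
  exact: integrable_norm.
have mI : (@measurable _ (measurableTypeR R)) `[0%R, +oo[%classic by [].
have di : leb.-integrable `[0, +oo[
    (EFin \o (fun x => r y x * f x * dens q x - r0 x * f x * dens q x)).
  have bi := integrableB mI ryi r0i.
  exact: bi.
rewrite (_ : _ - _ = Rintegral leb `[0, +oo[
    (fun x => r y x * f x * dens q x - r0 x * f x * dens q x)); last first.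
  by rewrite RintegralB.
apply: le_trans (le_normr_Rintegral _ di) _ => //.
rewrite /C -RintegralZl//; apply: le_Rintegral => //.
- exact: integrable_norm.
- by have ci := integrableZl mI (e y) ai; exact: ci.
- move=> x; rewrite /= in_itv/= andbT => x0.
  rewrite -!mulrA -mulrBl normrM ler_wpM2r//; exact: rey.
Qed.

(** [|f| <= 1 + |f|^p], and the constant 1 is integrable because [mu] is finite. *)
Lemma Lp_integrable p (f : R -> R) : 1 <= p -> Lp q p f ->
  leb.-integrable `[0, +oo[ (fun x => (f x * dens q x)%:E).
Proof.
move=> p1 [mf fp].
have mp : measurable_fun (`[0%R, +oo[%classic : set R) (fun x => `|f x| `^ p).
  by apply: (measurableT_comp (measurable_powR p)); exact: measurableT_comp.
have pi : leb.-integrable `[0, +oo[ (fun x => (`|f x| `^ p * dens q x)%:E).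
  apply/integrableP; split; first by apply/measurable_EFinP; exact: measurable_funM.
  apply: le_lt_trans fp; rewrite /muint le_eqVlt; apply/orP; left; apply/eqP.
  apply: eq_integral => x _.
  by rewrite gee0_abs// lee_fin mulr_ge0 ?powR_ge0// ltW// dens_gt0.
have mI : (@measurable _ (measurableTypeR R)) `[0%R, +oo[%classic by [].
have bi := integrableD mI dens_int pi; apply: le_integrable bi => //.
  by apply/measurable_EFinP; exact: measurable_funM.
move=> x _.
have : `|f x * dens q x| <= `|dens q x + `|f x| `^ p * dens q x|.
  rewrite -[X in X + _]mul1r -mulrDl !normrM ler_wpM2r//.
  rewrite [leRHS]ger0_norm ?addr_ge0 ?powR_ge0//.
  have [f1|f1] := leP `|f x| 1; first by rewrite (le_trans f1)// lerDl powR_ge0.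
  by rewrite (le_trans (le1r_powR (ltW f1) p1))// lerDr.
by rewrite -lee_fin.
Qed.

End limits.

(** * Convergence of the kernels in [L^p(mu)] and against integrable functions *)

Section psi_series_muint.
Set Implicit Arguments.
Unset Strict Implicit.
Context {R : realType}.
Local Notation leb := (@lebesgue_measure R).
Variables (q : R -> R) (psi : nat -> R -> R) (m al : nat -> R).
Hypothesis dens_int : leb.-integrable `[0%R, +oo[ (EFin \o dens q).
Hypothesis dens_cont : {within `[0%R, +oo[%classic, continuous (dens q)}.
Hypothesis psi_le : forall k x, 0 <= x -> `|psi k x| <= m k.
Hypothesis psi_cont : forall k, {within `[0%R, +oo[%classic, continuous (psi k)}.
Hypothesis al_ge0 : forall k, 0 <= al k.
Hypothesis alm_cvg : cvgn (series (fun k => al k * m k)).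

Lemma psi_series_measurable a : (forall k, `|a k| <= al k) ->
  measurable_fun (`[0%R, +oo[%classic : set R) (psi_series psi a).
Proof.
move=> aal; apply: within_continuous_measurable.
exact: (psi_series_continuous psi_le alm_cvg aal psi_cont).
Qed.

Lemma indic_dens_integrable (A : set R) : measurable A ->
  leb.-integrable `[0%R, +oo[ (fun x => (\1_A x * dens q x)%:E).
Proof.
move=> mA; apply: (@bounded_dens_integrable _ _ _ 1) => // x _.
by rewrite indicE; case: (x \in A); rewrite ?normr1 ?normr0.
Qed.

Lemma muint_indic (r : R -> R) (A : set R) : measurable A ->
  (\int[leb]_(x in A `&` `[0%R, +oo[%classic) (r x * dens q x)%:E)%E =
  muint q (fun x => r x * \1_A x).
Proof.
move=> mA; rewrite setIC integral_mkcondr; apply: eq_integral => x _.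
rewrite patchE indicE; case: (x \in A); first by rewrite mulr1.
by rewrite mulr0 mul0r.
Qed.

Lemma cvg_muint_psi_series {T : Type} (F : set_system T) {FF : Filter F}
    (a : T -> nat -> R) (l : nat -> R) (f : R -> R) :
  (forall k, a y k @[y --> F] --> l k) ->
  (\forall y \near F, forall k, `|a y k| <= al k) -> (forall k, `|l k| <= al k) ->
  measurable_fun (`[0%R, +oo[%classic : set R) f ->
  leb.-integrable `[0%R, +oo[ (fun x => (f x * dens q x)%:E) ->
  muint q (fun x => psi_series psi (a y) x * f x) @[y --> F] -->
  muint q (fun x => psi_series psi l x * f x).
Proof.
move=> al_ aal lal mf fi.
have [e e0 He] := psi_series_cvg_uniform psi_le al_ge0 alm_cvg al_ aal lal.
have bnd b x := @psi_series_bound _ _ _ _ psi_le alm_cvg b x.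
apply: (cvg_muint dens_cont _ _ _ He e0 mf fi).
- exact: psi_series_measurable.
- by move=> x; exact: bnd.
- apply: filterS aal => y ay; split; first exact: psi_series_measurable.
  by move=> x; exact: bnd.
Qed.

Lemma cvg_Lp_psi_series {T : Type} (F : set_system T) {FF : Filter F}
    (a : T -> nat -> R) (l : nat -> R) (p : R) : 1 <= p ->
  (forall k, a y k @[y --> F] --> l k) ->
  (\forall y \near F, forall k, `|a y k| <= al k) -> (forall k, `|l k| <= al k) ->
  muint q (fun x => `|psi_series psi (a y) x - psi_series psi l x| `^ p) @[y --> F]
    --> 0%E.
Proof.
move=> p1 al_ aal lal.
have [e e0 He] := psi_series_cvg_uniform psi_le al_ge0 alm_cvg al_ aal lal.
have If : (\int[leb]_(x in `[0%R, +oo[) (dens q x)%:E)%E \is a fin_num.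
  exact: integrable_fin_num.
have md : measurable_fun (`[0%R, +oo[%classic : set R) (dens q).
  exact: within_continuous_measurable.
pose C := fine (\int[leb]_(x in `[0%R, +oo[) (dens q x)%:E)%E.
have eC : (e y * C)%:E @[y --> F] --> 0%E.
  by apply: cvg_EFin; [exact: nearW|rewrite -[X in _ --> X](mul0r C); exact: cvgMl].
apply: (@squeeze_cvge _ _ _ _ (fun=> 0%E) _ (fun y => (e y * C)%:E)) => //; last first.
  exact: cvg_cst.
(* Once the uniform error is at most 1, its [p]-th power is no larger than itself, and the mass of
   [mu] times [e y] is a bound for every [p >= 1]. *)
have e1 : \forall y \near F, e y <= 1.
  have /cvgrPdist_le/(_ _ ltr01) := e0; apply: filterS => y.
  by rewrite sub0r normrN; apply: le_trans; exact: ler_norm.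
apply: filterS3 aal He e1 => y ay ey e1.
have d0 x : 0 <= dens q x by exact/ltW/dens_gt0.
apply/andP; split.
  by apply: integral_ge0 => x _; rewrite lee_fin mulr_ge0 ?powR_ge0.
have mr : measurable_fun (`[0%R, +oo[%classic : set R)
    (fun x => `|psi_series psi (a y) x - psi_series psi l x| `^ p).
  apply: (measurableT_comp (measurable_powR p)); apply: measurableT_comp => //.
  by apply: measurable_funB; exact: psi_series_measurable.
have ey0 : 0 <= e y by apply: le_trans (ey 0 (lexx 0)).
rewrite EFinM /C (fineK If) -ge0_integralZl_EFin//; first last.
- exact/measurable_EFinP.
- by move=> x _; rewrite lee_fin.
apply: ge0_le_integral => //.
- by move=> x _; rewrite lee_fin mulr_ge0 ?powR_ge0.
- by apply/measurable_EFinP; exact: measurable_funM.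
- by apply/measurable_EFinP; exact: measurable_funM.
move=> x; rewrite /= in_itv/= andbT => x0; rewrite -EFinM lee_fin ler_wpM2r//.
apply: le_trans (ey _ x0).
have := ey _ x0; move: (`|_|) (normr_ge0 (psi_series psi (a y) x - psi_series psi l x)).
move=> u; rewrite le_eqVlt => /predU1P[<- _|u0 ue].
  by rewrite powR0// gt_eqF// (lt_le_trans _ p1).
by apply: ge1r_powR => //; rewrite u0 (le_trans ue e1).
Qed.

Lemma psi_series_Lp a p : 1 <= p -> (forall k, `|a k| <= al k) ->
  Lp q p (psi_series psi a).
Proof.
move=> p1 aal; have mr := psi_series_measurable aal; split=> //.
have bi : leb.-integrable `[0%R, +oo[
    (fun x => (`|psi_series psi a x| `^ p * dens q x)%:E).
  apply: (@bounded_dens_integrable _ _ _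
    (limn (series (fun k => al k * m k)) `^ p)) => //.
    by apply: (measurableT_comp (measurable_powR p)); exact: measurableT_comp.
  move=> x x0; rewrite ger0_norm ?powR_ge0//.
  have b := psi_series_bound psi_le alm_cvg aal x0.
  by rewrite ge0_ler_powR// ?nnegrE ?(le_trans _ p1)// (le_trans _ b).
rewrite /muint -ge0_fin_numE; first exact: integrable_fin_num.
by apply: integral_ge0 => x _; rewrite lee_fin mulr_ge0 ?powR_ge0// ltW// dens_gt0.
Qed.

End psi_series_muint.

Theorem theorem1p7 (R : realType) (q dq : R -> R)
  (d : measure_display) (Omega : measurableType d) (P : probability Omega R)
  (B : R -> Omega -> R) (X : R -> R -> Omega -> R)
  (Xinf : R -> Omega -> R) (Tinf : Omega -> \bar R)
  (lam : nat -> R) (psi : nat -> R -> R) (psinf : nat -> R) (t : R) :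
  (* q in C^1([0,oo)) with derivative dq, and (H1), (H2), (H3) *)
  C1_on_halfline q dq -> H1 q -> H2 q dq -> H3 q ->
  (* B is a standard Brownian motion; X x is the solution started at x, stopped at 0 *)
  brownian_motion P B ->
  (forall x, 0 < x -> {ae P, forall w, stopped_solution q B x (X x) w}) ->
  (forall x s, measurable_fun setT (X x s)) ->
  (forall x, measurable_fun [set: Omega] (fun w => hit (fun s => X x s w) 0 : \bar R)) ->
  (* X^oo_t = lim_x X^x_t and T^oo_0 = lim_x T^x_0 (a.s.) *)
  {ae P, forall w, (X x t w @[x --> +oo] --> Xinf t w) /\
                   (hit (fun s => X x s w) 0 @[x --> +oo] --> Tinf w)} ->
  measurable_fun setT (Xinf t) -> measurable_fun setT Tinf ->
  (* known spectral facts *)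
  0 < lam 0%N -> (forall k, lam k < lam k.+1) ->
  (forall k, psi k 0 = 0 /\ {within `[0%R, +oo[%classic, continuous (psi k)} /\
     forall x, 0 < x -> derivable (psi k) x 1 /\ derivable (derive1 (psi k)) x 1 /\
       2^-1 * derive1 (derive1 (psi k)) x - q x * derive1 (psi k) x = - lam k * psi k x) ->
  (forall i j, muint q (fun x => psi i x * psi j x) = (i == j)%:R%:E) ->
  (forall k, exists M, forall x, 0 <= x -> `|psi k x| <= M) ->
  (forall k, psi k x @[x --> +oo] --> psinf k) ->
  (forall y s, 0 < y -> 0 < s -> forall A : set R, measurable A ->
     P [set w | A (X y s w) /\ (s%:E < hit (fun u => X y u w) 0)%E] =
     (\int[lebesgue_measure]_(x in A `&` `[0%R, +oo[%classic)
         (rker lam (fun k => psi k y) psi s x * dens q x)%:E)%E) ->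
  0 < t ->
  let rinf := rker lam psinf psi t in
  (* (i) *)
  ((forall x, 0 <= x ->
      cvgn (series (fun k => expR (- lam k * t) * psinf k * psi k x))) /\
   (forall p, 1 <= p ->
      muint q (fun x => (`|rker lam (fun k => psi k y) psi t x - rinf x| `^ p)%R)
        @[y --> +oo] --> 0%E) /\
   (forall p, 1 <= p -> Lp q p rinf) /\
   (exists M, forall x, 0 <= x -> `|rinf x| <= M) /\
   {within `[0%R, +oo[%classic, continuous rinf}) /\
  (* (ii) *)
  (forall f : R -> R, measurable_fun (`[0%R, +oo[%classic : set R) f ->
     (exists M, forall x, 0 <= x -> `|f x| <= M) ->
     (\int[P]_(w in [set w | (t%:E < Tinf w)%E]) (f (Xinf t w))%:E)%E =
     muint q (fun x => rinf x * f x)) /\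
  (* (iii) *)
  (forall (p : R) (f : R -> R), 1 <= p -> Lp q p f ->
     ((\int[P]_(w in [set w | (t%:E < hit (fun s => X z s w) 0)%E]) (f (X z t w))%:E)%E
        @[z --> +oo] -->
      (\int[P]_(w in [set w | (t%:E < Tinf w)%E]) (f (Xinf t w))%:E)%E) /\
     (\int[P]_(w in [set w | (t%:E < Tinf w)%E]) (f (Xinf t w))%:E)%E =
       muint q (fun x => rinf x * f x)).
Proof.
move=> C1q Hq1 Hq2 Hq3 _ _ mX mhit XTlim mXi mTi lam0 lamS psiP ortho psiM psinf_cvg kern t0 rinf.
have [di dc [m [m0 psi_le alm]]] := spectral_summable C1q Hq1 Hq2 Hq3 lam0 lamS psiP ortho psiM t0.
have lam_gt0 k : 0 < lam k by elim: k => // k ih; exact: lt_trans (lamS k).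
have psi_cont k : {within `[0%R, +oo[%classic, continuous (psi k)}.
  by have [_ []] := psiP k.
(* The majorant is frozen at time [t] and serves all [s >= t], as the limit [s -> t^'+] demands. *)
pose al k := expR (- lam k * t) * m k.
have al0 k : 0 <= al k by rewrite mulr_ge0 ?expR_ge0.
have psinf_le k : `|psinf k| <= m k.
  apply: (cvgr_to_le (cvg_norm (psinf_cvg k))); near=> y.
  by apply: psi_le; near: y; apply: nbhs_pinfty_ge; exact: num_real.
have coef_le s (c : nat -> R) k : t <= s -> `|c k| <= m k ->
    `|expR (- lam k * s) * c k| <= al k.
  move=> ts ck; rewrite normrM (ger0_norm (expR_ge0 _)) ler_pM ?expR_ge0//.
  by rewrite ler_expR !mulNr lerN2 ler_wpM2l// ltW.
pose cy (s y : R) k := expR (- lam k * s) * psi k y.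
pose ci (s : R) k := expR (- lam k * s) * psinf k.
have cy_le s y : t <= s -> 0 <= y -> forall k, `|cy s y k| <= al k.
  by move=> ts y0 k; exact: (coef_le s (psi^~ y) k ts (psi_le k y y0)).
have ci_le s : t <= s -> forall k, `|ci s k| <= al k.
  by move=> ts k; exact: (coef_le s psinf k ts (psinf_le k)).
have cy_cvg s k : cy s y k @[y --> +oo] --> ci s k by apply: cvgMr; exact: psinf_cvg.
have cy_near s : t <= s -> \forall y \near +oo, forall k, `|cy s y k| <= al k.
  move=> ts; near=> y.
  have y0 : 0 <= y by near: y; apply: nbhs_pinfty_ge; exact: num_real.
  exact: cy_le.
have d0 x : 0 <= dens q x by exact/ltW/dens_gt0.
(* The starting points are sampled along [n.+1], so that every one of them is positive, as the
   kernel formula requires. *)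
have succ_cvgy : (n.+1%:R : R) @[n --> \oo] --> +oo.
  apply/cvgryPge => A; near=> n; have : A <= n%:R by near: n; exact: nbhs_infty_ger.
  by move=> /le_trans; apply; rewrite ler_nat.

have kernE y s : 0 < y -> t <= s -> forall A : set R, measurable A ->
    P (X y s @^-1` A `&` [set w | (s%:E < hit (fun u => X y u w) 0)%E]) =
    (\int[lebesgue_measure]_(x in A `&` `[0%R, +oo[%classic)
      (psi_series psi (cy s y) x * dens q x)%:E)%E.
  by move=> y0 ts A mA; apply: kern => //; exact: lt_le_trans ts.
have law_cvg s (A : set R) : t <= s -> measurable A ->
    P (X n.+1%:R s @^-1` A `&` [set w | (s%:E < hit (fun u => X n.+1%:R u w) 0)%E])
      @[n --> \oo] --> muint q (fun x => psi_series psi (ci s) x * \1_A x).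
  move=> ts mA.
  have mI : measurable_fun (`[0%R, +oo[%classic : set R) (\1_A : R -> R).
    by apply: measurable_funTS; exact: measurable_indic.
  have /cvge_pinftyP h : muint q (fun x => psi_series psi (cy s y) x * \1_A x)
      @[y --> +oo] --> muint q (fun x => psi_series psi (ci s) x * \1_A x).
    exact: (cvg_muint_psi_series dc psi_le psi_cont al0 alm (cy_cvg s) (cy_near s ts)
      (ci_le s ts) mI (indic_dens_integrable di mA)).
  apply: cvg_trans (h _ succ_cvgy).
  apply: near_eq_cvg; apply: nearW => n.
  by rewrite kernE// muint_indic.
(* Positivity is not visible in the spectral series; it comes from the left-hand side of [kernE], a
   probability. *)
have ry_ge0 y : 0 < y -> forall x, 0 <= x -> 0 <= psi_series psi (cy t y) x.
  move=> y0; apply: (density_ge0 dc).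
    exact: (psi_series_continuous psi_le alm (cy_le t y (lexx t) (ltW y0)) psi_cont).
  by move=> A mA; rewrite -kernE.
have [e e0 He] := psi_series_cvg_uniform psi_le al0 alm (cy_cvg t)
  (cy_near t (lexx t)) (ci_le t (lexx t)).
have rinf_ge0 x : 0 <= x -> 0 <= rinf x.
  move=> x0.
  have : psi_series psi (cy t y) x @[y --> +oo] --> rinf x.
    apply/subr_cvg0; apply: (norm_le_cvg0 _ e0).
    by apply: filterS He => y; apply.
  move=> /(cvgr_to_ge); apply; near=> y.
  have y0 : 0 < y by near: y; apply: nbhs_pinfty_gt; exact: num_real.
  exact: ry_ge0.
have mrinf : measurable_fun (`[0%R, +oo[%classic : set R) rinf.
  exact: (psi_series_measurable psi_le psi_cont alm (ci_le t (lexx t))).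
have md := within_continuous_measurable dc.
pose dinf := (fun x => (rinf x * dens q x)%:E) \_ (`[0%R, +oo[%classic : set R).
have mdinf : measurable_fun (setT : set (measurableTypeR R)) dinf.
  have mI : (@measurable _ (measurableTypeR R)) `[0%R, +oo[%classic by [].
  apply/(measurable_restrictT _ mI).
  by apply/measurable_EFinP; exact: measurable_funM.
have dinf0 x : (0 <= dinf x)%E.
  rewrite /dinf patchE; case: ifPn => //; rewrite inE/= in_itv/= andbT => x0.
  by rewrite lee_fin mulr_ge0// rinf_ge0.
(* The image under the identity carries the measure from [measurableTypeR R], where Lebesgue measure
   lives, to [R]. *)
pose rho := law_on (density_measure lebesgue_measure mdinf dinf0) measurableT
  (@measurable_id _ (measurableTypeR R) setT).
have rhoE (A : set R) : measurable A -> rho A = muint q (fun x => rinf x * \1_A x).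
  move=> mA; rewrite /rho /law_on /density_measure setIT preimage_id.
  by rewrite -muint_indic// integral_mkcondr.
have muint_fin s (A : set R) : t <= s -> measurable A ->
    muint q (fun x => psi_series psi (ci s) x * \1_A x) \is a fin_num.
  move=> ts mA; apply: integrable_fin_num => //.
  have mI : measurable_fun (`[0%R, +oo[%classic : set R) (\1_A : R -> R).
    by apply: measurable_funTS; exact: measurable_indic.
  exact: (bounded_mul_integrable dc
    (psi_series_measurable psi_le psi_cont alm (ci_le s ts)) mI
    (fun x => psi_series_bound psi_le alm (ci_le s ts)) (indic_dens_integrable di mA)).
have limE (A : set R) : measurable A ->
    P (Xinf t @^-1` A `&` [set w | (t%:E < Tinf w)%E]) = rho A.
  (* The role of [M s] is played by the total mass of [r(s,oo,.)], the limit of the survival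
     probabilities at time [s]. *)
  apply: (@limit_law _ _ _ P (fun n => X n.+1%:R t)
    (fun n w => hit (fun s => X n.+1%:R s w) 0) (Xinf t) Tinf t _ _ _ _ _ rho
    (fun s => fine (muint q (fun x => psi_series psi (ci s) x * \1_setT x)))) => //.
  - apply: filterS XTlim => w [Xw Tw]; split.
      by move/cvg_pinftyP : Xw; apply.
    by move/cvge_pinftyP : Tw; apply.
  - move=> A' mA'; have := law_cvg t A' (lexx t) mA'.
    by rewrite -[X in _ --> X](rhoE A' mA').
  - move=> s ts; rewrite fineK ?muint_fin ?ltW//.
    have := law_cvg s setT (ltW ts) measurableT.
    apply: cvg_trans; apply: near_eq_cvg; apply: nearW => n.
    by rewrite preimage_setT setTI.
  (* Only the factors [e^(- lam_k s)] move with [s], so the convergence result used for [y -> +oo]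
     applies along [t^'+]. *)
  - suff : fine (muint q (fun x => psi_series psi (ci s) x * \1_setT x)) @[s --> t^'+]
        --> fine (rho setT) by [].
    rewrite rhoE//; apply: fine_cvg; rewrite fineK ?muint_fin//.
    have mI : measurable_fun (`[0%R, +oo[%classic : set R) (\1_setT : R -> R).
      by apply: measurable_funTS; exact: measurable_indic.
    apply: (@cvg_muint_psi_series _ _ _ _ _ dc psi_le psi_cont al0 alm _ _ _
      ci (ci t) \1_setT _ _ (ci_le t (lexx t)) mI (indic_dens_integrable di measurableT)).
    + move=> k; apply: cvgMl; apply: cvg_at_right_filter.
      apply: continuous_comp; last exact: continuous_expR.
      by apply: cvgMr; exact: cvg_id.
    + by near=> s; apply: ci_le; near: s; exact: nbhs_right_ge.
have mE : measurable [set w | (t%:E < Tinf w)%E].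
  by rewrite -[X in measurable X]setTI; exact: emeasurable_fun_o_infty.
(* An identity in the extended reals, which covers bounded and [L^p] functions at once. *)
have intE f : measurable_fun (`[0%R, +oo[%classic : set R) f ->
    (\int[P]_(w in [set w | (t%:E < Tinf w)%E]) (f (Xinf t w))%:E)%E =
    muint q (fun x => rinf x * f x).
  apply: (density_integral dc mE mXi mrinf rinf_ge0) => A mA.
  by rewrite (muint_indic q rinf mA) -(rhoE A mA); exact: limE.
split; first split.
- by move=> x x0; exact: (psi_series_cvg psi_le alm (ci_le t (lexx t)) x0).
- split.
    move=> p p1.
    exact: (cvg_Lp_psi_series di dc psi_le psi_cont al0 alm p1 (cy_cvg t)
      (cy_near t (lexx t)) (ci_le t (lexx t))).
  split; first by move=> p p1;
    exact: (psi_series_Lp di psi_le psi_cont alm p1 (ci_le t (lexx t))).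
  split; last exact: (psi_series_continuous psi_le alm (ci_le t (lexx t)) psi_cont).
  exists (limn (series (fun k => al k * m k))) => x x0.
  exact: (psi_series_bound psi_le alm (ci_le t (lexx t)) x0).
split; first by move=> f mf _; exact: intE.
move=> p f p1 Lpf; have fi := Lp_integrable di dc p1 Lpf; case: Lpf => mf _.
split; last exact: intE.
rewrite intE//.
(* By [density_integral] both expectations are integrals against kernels, and uniform convergence of
   these suffices since [f] is in [L^1(mu)]. *)
have h : muint q (fun x => psi_series psi (cy t y) x * f x) @[y --> +oo] -->
    muint q (fun x => psi_series psi (ci t) x * f x).
  exact: (cvg_muint_psi_series dc psi_le psi_cont al0 alm (cy_cvg t)
    (cy_near t (lexx t)) (ci_le t (lexx t)) mf fi).
apply: cvg_trans h; apply: near_eq_cvg; near=> z.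
have z0 : 0 < z by near: z; apply: nbhs_pinfty_gt; exact: num_real.
apply/esym; apply: (density_integral dc) => //.
- rewrite -[X in measurable X]setTI; exact: emeasurable_fun_o_infty.
- exact: (psi_series_measurable psi_le psi_cont alm (cy_le t z (lexx t) (ltW z0))).
- exact: ry_ge0.
- exact: kernE.
Unshelve. all: by end_near. Qed.
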